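(* Let $L\in\mathbb{C}^{(d+1)\times(n+1)}$ be of rank $d+1$. Let $\mathbb{L}\subset\mathbb{P}^n$ be a linear subspace of dimension $n-d$ which intersects $\mathcal{R}_L$ in $\deg\mathcal{R}_L$ many points, counting multiplicities (in particular in finitely many points), and let $I(\mathbb{L})$ be its ideal in $\mathbb{C}[\mathcal{R}_L]$. Then the Hilbert function $\mathrm{HF}_{\mathbb{L}\cap\mathcal{R}_L}(q)=\dim_{\mathbb{C}}\mathbb{C}[\mathcal{R}_L]_q/I(\mathbb{L})_q$ equals $\deg\mathcal{R}_L$ for all $q\ge d$.
   Context: Put $(\ell_0(x),\ldots,\ell_n(x))=(1,x_1,\ldots,x_d)\cdot L$, where each $\ell_i$ is assumed non-constant (so it defines a hyperplane in $\mathbb{C}^d$). Let $X=\mathbb{C}^d\setminus V(\ell_0\cdots\ell_n)$ and $\phi:X\to\mathbb{P}^n$, $x\mapsto(\ell_0^{-1}(x):\cdots:\ell_n^{-1}(x))$. The reciprocal linear space $\mathcal{R}_L\subset\mathbb{P}^n$ is the Zariski closure of $\operatorname{im}\phi$; since $L$ has rank $d+1$, it is an irreducible $d$-dimensional projective variety. Its homogeneous coordinate ring is the graded ring $\mathbb{C}[\mathcal{R}_L]=\mathbb{C}[y_0,\ldots,y_n]/I(\mathcal{R}_L)$, where $I(\mathcal{R}_L)$ is the homogeneous vanishing ideal. The ideal $I(\mathbb{L})\subset\mathbb{C}[\mathcal{R}_L]$ is the homogeneous ideal generated by the classes of the ($d$ linearly independent) linear forms defining $\mathbb{L}$. The subscript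 $q$ denotes the degree-$q$ graded piece. *)

(* Defs.v *)
From HB Require Import structures.
From mathcomp Require Import all_boot all_order all_algebra.
From mathcomp Require Export reals complex mpoly.

Set Implicit Arguments.
Unset Strict Implicit.
Unset Printing Implicit Defensive.

Import GRing.Theory.
Local Open Scope ring_scope.

(* The K-vector space V / (V :&: W) has dimension m.  Here V and W are
   subspaces of M, and the action sc of K on M is explicit because function
   fields carry no canonical lmodType structure over K. *)
Definition has_quot_dim (K : fieldType) (M : zmodType) (sc : K -> M -> M)
    (V W : M -> Prop) (m : nat) : Prop :=
  exists b : 'I_m -> M,
    [/\ forall i, V (b i),
        forall v, V v -> exists c : 'I_m -> K, W (v - \sum_i sc (c i) (b i))
      & forall c : 'I_m -> K, W (\sum_i sc (c i) (b i)) -> forall i, c i = 0].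

Definition ideal_gen (A : comNzRingType) (G : A -> Prop) (f : A) : Prop :=
  exists2 s : seq (A * A),
    (forall u, u \in s -> G u.2) & f = \sum_(u <- s) u.1 * u.2.

(* A point of P^n is a nonzero row vector, taken up to proj_eq; a subset of
   P^n is a scaling-invariant predicate on nonzero row vectors, or any
   predicate choosing representatives of its points. *)
Definition proj_eq (K : fieldType) (n : nat) (u v : 'rV[K]_n.+1) : Prop :=
  exists2 c : K, c != 0 & u = c *: v.

Definition homogeneous (K : fieldType) (n : nat) (f : {mpoly K[n.+1]}) : Prop :=
  exists k : nat, f \is k.-homog.

Definition proj_closed (K : fieldType) (n : nat) (Z : 'rV[K]_n.+1 -> Prop) :
    Prop :=
  exists2 E : {mpoly K[n.+1]} -> Prop,
    forall f, E f -> homogeneous f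
  & forall v, Z v <-> v != 0 /\ (forall f, E f -> f.@[v 0] = 0).

Definition zariski_closure (K : fieldType) (n : nat)
    (S : 'rV[K]_n.+1 -> Prop) (v : 'rV[K]_n.+1) : Prop :=
  forall Z, proj_closed Z -> (forall u, S u -> Z u) -> Z v.

Definition vanishing_ideal (K : fieldType) (n : nat) (Z : 'rV[K]_n.+1 -> Prop) :
    {mpoly K[n.+1]} -> Prop :=
  ideal_gen (fun f => homogeneous f /\ forall v, Z v -> f.@[v 0] = 0).

(* dim_K (K[y]/J)_q = h *)
Definition hilbert_function (K : fieldType) (n : nat)
    (J : {mpoly K[n.+1]} -> Prop) (q h : nat) : Prop :=
  has_quot_dim (fun (c : K) f => c *: f)
    (fun f : {mpoly K[n.+1]} => f \is q.-homog) J h.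

(* r! times the leading coefficient of the Hilbert polynomial, r being the
   degree of that polynomial, i.e. the dimension of Z. *)
Definition proj_degree (K : fieldType) (n : nat) (Z : 'rV[K]_n.+1 -> Prop)
    (e : nat) : Prop :=
  exists2 P : {poly rat},
    exists N : nat, forall q : nat, (N <= q)%N ->
      exists2 h : nat, hilbert_function (vanishing_ideal Z) q h
                     & P.[q%:R] = h%:R
  & e%:R = ((size P).-1)`!%:R * lead_coef P.

(* The linear subspace of P^n attached to U has projective dimension
   \dim U - 1; its linear equations are the linear forms vanishing on U. *)
Definition linear_equation (K : fieldType) (n : nat)
    (U : {vspace 'rV[K]_n.+1}) (l : {mpoly K[n.+1]}) : Prop :=
  l \is 1.-homog /\ forall v, v \in U -> l.@[v 0] = 0.

(* An ideal of the coordinate ring K[y]/I(Z) is given by its preimage in K[y]: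
   f satisfies section_ideal Z U when its class mod I(Z) lies in the ideal of
   K[y]/I(Z) generated by the classes of the linear equations of U.  As
   I(Z) is contained in it, (K[y]/section_ideal Z U)_q is the quotient of the
   degree q piece of the coordinate ring by that of this ideal. *)
Definition section_ideal (K : fieldType) (n : nat) (Z : 'rV[K]_n.+1 -> Prop)
    (U : {vspace 'rV[K]_n.+1}) (f : {mpoly K[n.+1]}) : Prop :=
  exists2 g, ideal_gen (linear_equation U) g & vanishing_ideal Z (f - g).

(* Inside the fraction field of K[y]: the extension of the homogeneous ideal J
   to the local ring of P^n at p; for J the unit ideal, the local ring itself. *)
Definition local_fractions (K : fieldType) (n : nat)
    (J : {mpoly K[n.+1]} -> Prop) (p : 'rV[K]_n.+1)
    (x : {fraction {mpoly K[n.+1]}}) : Prop :=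
  exists k (f g : {mpoly K[n.+1]}),
    [/\ f \is k.-homog, g \is k.-homog, g.@[p 0] != 0, J f
      & x = FracField.tofrac f / FracField.tofrac g].

(* Length at p of the subscheme of P^n defined by the homogeneous ideal J. *)
Definition multiplicity (K : fieldType) (n : nat)
    (J : {mpoly K[n.+1]} -> Prop) (p : 'rV[K]_n.+1) (m : nat) : Prop :=
  has_quot_dim (fun (c : K) x => FracField.tofrac c%:MP * x)
    (local_fractions (fun=> True) p) (local_fractions J p) m.

(* Z and the linear subspace of U have finitely many common points, whose
   multiplicities on the scheme-theoretic intersection add up to e. *)
Definition meets_in_points (K : fieldType) (n : nat) (Z : 'rV[K]_n.+1 -> Prop)
    (U : {vspace 'rV[K]_n.+1}) (e : nat) : Prop :=
  exists (m : nat) (p : 'I_m -> 'rV[K]_n.+1) (mu : 'I_m -> nat),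
    [/\ forall i, [/\ Z (p i), p i \in U
                    & multiplicity (section_ideal Z U) (p i) (mu i)],
        forall i j, proj_eq (p i) (p j) -> i = j,
        forall v, Z v -> v \in U -> exists i, proj_eq v (p i)
      & \sum_i mu i = e]%N.

Definition ell (K : fieldType) (d n : nat) (L : 'M[K]_(1 + d, n.+1))
    (x : 'rV[K]_d) (i : 'I_n.+1) : K :=
  (row_mx 1%:M x *m L) 0 i.

Definition recip_image (K : fieldType) (d n : nat) (L : 'M[K]_(1 + d, n.+1))
    (v : 'rV[K]_n.+1) : Prop :=
  exists2 x : 'rV[K]_d,
    forall i, ell L x i != 0 & v = \row_i (ell L x i)^-1.

Definition recip_space (K : fieldType) (d n : nat) (L : 'M[K]_(1 + d, n.+1)) :
    'rV[K]_n.+1 -> Prop :=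
  zariski_closure (recip_image L).

(* Main.v *)
(* The coordinate ring S of the reciprocal linear space is the Orlik-Terao
   algebra, generated by the reciprocals of the coordinates on the row space W
   of L.  Deletion and contraction of a coordinate show, together with the fact
   that its relations are generated by circuits, that some sequence of
   d + 1 linear forms is regular on S with multiples filling S in degree d + 1; the
   contraction is the restriction to a hyperplane and governs the poles along
   it.  Regularity then holds for every sequence of d + 1 linear forms with
   quotient of finite length, by exchanging forms along generic pencils.  The
   equations of the linear subspace are completed to such a sequence by a linear
   form avoiding the finitely many intersection points, by the Nullstellensatz.
   Hence the last form is a nonzero divisor modulo the others and surjective in
   degrees above d, so the Hilbert function is constant from d on, and comparing
   it with the d-th difference of the Hilbert polynomial identifies the constant
   with the degree. *)

From HB Require Import structures.
Require Import Defs.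
From mathcomp Require Import all_boot all_order all_algebra.
From mathcomp Require Import boolp.
From mathcomp Require Import ring zify.

Set Implicit Arguments.
Unset Strict Implicit.
Unset Printing Implicit Defensive.

Import Order.TTheory GRing.Theory Num.Theory.
Import VectorInternalTheory.
Local Open Scope ring_scope.

(** * Linear algebra *)

Section LinearAlgebra.
Variable K : closedFieldType.

(** All arguments take place in the finite-dimensional graded pieces. Genericity means avoiding a
    finite spectrum, and nonzero divisors are recognised by comparing dimensions. For a nonloop with
    variable [y], sorting by powers of [y] splits the coordinate ring, as a vector space, into the
    ring of the deletion and the products of positive powers of [y] with the ring of the
    contraction. That leading coefficients vanish on the contraction is a limit along a line of the
    row space. That every element of the contraction ideal is such a coefficient requires explicit
    generators, hence the circuits. The bound d + 1 comes from this splitting: deletion keeps the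
    rank, and contraction lowers it by one, which the factor [y] makes up for. The obstacle is that
    one sequence must serve both rings, although their ranks r + 1 and r differ: r common forms are
    chosen in a generic pencil, and the last form is perturbed by a multiple of [y]. Coloops (the
    deletion loses rank) and parallel elements (the contraction gains further loops) are treated
    apart. *)

Lemma closed_field_roots (p : {poly K}) :
  p != 0 -> exists s : seq K, forall t, root p t -> t \in s.
Proof.
move=> p0; have [s ps] := closed_field_poly_normal p; exists s => t.
by rewrite ps rootZ ?lead_coef_eq0 // root_prod_XsubC.
Qed.

Lemma lfun_r2v (E : vectType K) (C : 'End(E)) (u : 'rV_(dim E)) :
  C (r2v u) = r2v (u *m f2mx C).
Proof. by rewrite unlock /= r2vK. Qed.

Lemma lfun_finite_spectrum (E : vectType K) (C : 'End(E)) :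
  exists s : seq K, forall t v, t \notin s -> C v = t *: v -> v = 0.
Proof.
have cp0 : char_poly (f2mx C) != 0 by rewrite monic_neq0 ?char_poly_monic.
have [s rs] := closed_field_roots cp0; exists s => t v ts Cv.
apply/eqP; apply: contraNT ts => v0; apply: rs.
rewrite -eigenvalue_root_char; apply/eigenvalueP; exists (v2r v).
  by apply: r2v_inj; rewrite -lfun_r2v v2rK Cv -[in LHS](v2rK v) linearZ.
by apply: contraNneq v0 => /esym/(canLR v2rK) <-; rewrite linear0.
Qed.

Lemma lfun_eigenvector (E : vectType K) (C : 'End(E)) (w : E) :
  w != 0 -> exists t v, v != 0 /\ C v = t *: v.
Proof.
move=> w0.
have [t] : exists t, root (char_poly (f2mx C)) t.
  apply/closed_rootP; rewrite size_char_poly eqSS.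
  apply: contraNneq w0 => d0; rewrite -[w]v2rK (_ : v2r w = 0) ?linear0 //.
  by apply/rowP => i; have := ltn_ord i; rewrite {2}d0.
rewrite -eigenvalue_root_char => /eigenvalueP[v vC v0].
exists t, (r2v v); split; first by apply: contraNneq v0 => /esym/(canLR r2vK) <-; rewrite linear0.
by rewrite lfun_r2v vC linearZ.
Qed.

(** Choose partners for a basis and extend linearly. This makes non-unique decompositions depend
    linearly on the element decomposed. *)
Lemma linear_relation_graph (E F : vectType K) (Rel : E -> F -> Prop) :
  (forall c e e' f f', Rel e f -> Rel e' f' -> Rel (c *: e + e') (c *: f + f')) ->
  Rel 0 0 ->
  (forall e, exists f, Rel e f) ->
  exists B : 'Hom(E, F), forall e, Rel e (B e).
Proof.
move=> RelD Rel0 tot; pose b := vbasis (fullv : {vspace E}).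
have [c cP] := boolp.choice
  (fun i : 'I_(\dim (fullv : {vspace E})) => tot b`_i).
pose B0 e := \sum_i coord b i e *: c i.
have B0l : linear B0.
  move=> a u v; rewrite /B0 scaler_sumr -big_split /=; apply: eq_bigr => i _.
  by rewrite linearP scalerDl scalerA.
pose B0L : {linear E -> F} := HB.pack B0 (GRing.isLinear.Build _ _ _ _ _ B0l).
exists (linfun B0L) => e; rewrite lfunE /= /B0.
have {1}-> : e = \sum_i coord b i e *: b`_i by apply: coord_vbasis; rewrite memvf.
elim/big_rec2: _ => [|i f e' _ re] //; exact: RelD.
Qed.

(** A kernel vector of 1 + t C with t nonzero is an eigenvector of [C] for -1/t, so finitely many
    [t] are bad; for the others injectivity gives surjectivity. *)
Lemma end_pencil (E : vectType K) (C : 'End(E)) :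
  exists s : seq K, forall t, t \notin s ->
    forall v, exists u, u + t *: C u = v.
Proof.
have [s sP] := lfun_finite_spectrum C.
exists [seq - x^-1 | x <- s] => t ts.
suff k0 : lker (\1 + t *: C)%VF == 0%VS.
  move=> v; exists ((\1 + t *: C)^-1 v)%VF.
  have /(_ v) := lker0_lfunVK k0.
  by rewrite add_lfunE scale_lfunE id_lfunE.
apply/eqP/vspaceP => v; rewrite memv_ker memv0 add_lfunE scale_lfunE id_lfunE.
apply/eqP/eqP => [v0 | ->]; last by rewrite linear0 scaler0 addr0.
have [t0|t0] := eqVneq t 0; first by rewrite t0 scale0r addr0 in v0.
apply: (sP (- t^-1)).
  by apply: contra ts => ts; apply/mapP; exists (- t^-1); rewrite // invrN invrK opprK.
apply: (scalerI t0); rewrite scalerA mulrN divff // scaleN1r.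
by apply/eqP; rewrite -addr_eq0 addrC v0.
Qed.

(** Modulo [G] the map [a] is injective on [D]; composing [b] with a left inverse of it gives an
    endomorphism of [D], and a bad nonzero [t] produces its eigenvalue -1/t. *)
Lemma pencil_inj (V E : vectType K) (a b : 'Hom(V, E))
    (D : {vspace V}) (G : {vspace E}) :
  (forall f, f \in D -> a f \in G -> f = 0) ->
  exists s : seq K, forall t, t \notin s ->
    forall f, f \in D -> a f + t *: b f \in G -> f = 0.
Proof.
move=> ainj.
have [pr prE] : exists pr : 'End(E), forall e, (pr e == 0) = (e \in G).
  exists (\1 - projv G)%VF => e; rewrite add_lfunE opp_lfunE id_lfunE subr_eq0; apply/eqP/idP => [->|eG].
    exact: memv_proj.
  by rewrite projv_id.
pose phi : 'Hom(subvs_of D, E) := (pr \o a \o linfun vsval)%VF.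
have kphi : lker phi == 0%VS.
  apply/eqP/vspaceP => v; rewrite memv_ker memv0 !comp_lfunE lfunE /= prE.
  apply/idP/eqP => [aG|->]; last by rewrite linear0 mem0v.
  by apply: val_inj => /=; apply: ainj aG; apply: subvsP.
pose C : 'End(subvs_of D) := (phi^-1 \o pr \o b \o linfun vsval)%VF.
have [s sP] := lfun_finite_spectrum C.
exists [seq - x^-1 | x <- s] => t ts f fD fG.
have [t0|t0] := eqVneq t 0.
  by apply: ainj fD _; move: fG; rewrite t0 scale0r addr0.
pose f' : subvs_of D := vsproj D f.
have f'E : vsval f' = f by rewrite vsprojK.
suff -> : f = vsval (0 : subvs_of D) by [].
rewrite -f'E; congr (vsval _); apply: (sP (- t^-1)).
  by apply: contra ts => ts; apply/mapP; exists (- t^-1); rewrite // invrN invrK opprK.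
apply: (scalerI t0); rewrite scalerA mulrN divff // scaleN1r.
have e0 : (phi^-1 (pr (a f + t *: b f)) = 0)%VF.
  by move: fG; rewrite -prE => /eqP ->; rewrite linear0.
move: e0; rewrite !linearD !linearZ /=.
have -> : pr (a f) = phi f' by rewrite !comp_lfunE lfunE /= f'E.
rewrite lker0_lfunK // !comp_lfunE lfunE /= f'E => e0.
by apply/eqP; rewrite -addr_eq0 addrC e0.
Qed.

(** Surjectivity of [a] modulo [G] allows a linear choice of [C] on [D] with a (C u) congruent to b
    u; an eigenvector of [C] is the required [f]. *)
Lemma pencil_eigen (V E : vectType K) (a b : 'Hom(V, E))
    (D : {vspace V}) (G : {vspace E}) (w : V) :
  w \in D -> w != 0 ->
  (forall e, exists2 f, f \in D & e - a f \in G) ->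
  exists t f, [/\ f \in D, f != 0 & b f - t *: a f \in G].
Proof.
move=> wD w0 asurj.
pose Rel (f g : subvs_of D) := b (vsval f) - a (vsval g) \in G.
have [||u|C CP] := @linear_relation_graph (subvs_of D) (subvs_of D) Rel.
- move=> c e e' f f'; rewrite /Rel => h h'.
  rewrite !linearP /=. rewrite addrACA -scalerDr; exact: memvD (memvZ _ h) h'.
- by rewrite /Rel /= !linear0 addr0 mem0v.
- have [f fD fG] := asurj (b (vsval u)).
  by exists (vsproj D f); rewrite /Rel vsprojK.
have [|t [v [v0 Cv]]] := @lfun_eigenvector _ C (vsproj D w).
  by apply: contraNneq w0 => e; rewrite -(vsprojK wD) e linear0.
exists t, (vsval v); split; first exact: subvsP.
  by apply: contraNneq v0 => e; apply/eqP/val_inj; rewrite /= e.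
by have := CP v; rewrite /Rel Cv !linearZ.
Qed.

Lemma dim_add_line (E : vectType K) (U : {vspace E}) (v : E) :
  v \notin U -> (\dim U < \dim (U + <[v]>))%N.
Proof.
move=> vU; rewrite ltn_neqAle (dimvS (addvSl _ _)) andbT.
apply: contra vU => /eqP e; have /eqP -> : U == (U + <[v]>)%VS.
  by rewrite eqEdim addvSl e leqnn.
by rewrite (subvP (addvSr _ _)) // memv_line.
Qed.

Lemma exists_vspace (E : vectType K) (P : E -> Prop) :
  P 0 -> (forall c u v, P u -> P v -> P (c *: u + v)) ->
  exists U : {vspace E}, forall u, u \in U <-> P u.
Proof.
move=> P0 PD.
have PD' (U : {vspace E}) : (forall u, u \in U -> P u) -> forall v, P v ->
    forall u, u \in (U + <[v]>)%VS -> P u.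
  move=> UP v Pv u /memv_addP[x xU [y /vlineP[c ->]] ->].
  by rewrite addrC; apply: PD => //; apply: UP.
suff main k : forall U : {vspace E}, (forall u, u \in U -> P u) ->
    (dim E - \dim U <= k)%N ->
    exists U : {vspace E}, forall u, u \in U <-> P u.
  apply: (main (dim E) 0%VS); last exact: leq_subr.
  by move=> u; rewrite memv0 => /eqP ->.
elim: k => [|k IH] U UP dU.
  exists U => u; split=> [|_]; first exact: UP.
  suff /eqP -> : U == fullv by rewrite memvf.
  by rewrite eqEdim subvf /= dimvf -subn_eq0 -leqn0.
have [[v Pv vU]|noP] := pselect (exists2 v, P v & v \notin U); last first.
  exists U => u; split=> [|Pu]; first exact: UP.
  by apply/negPn/negP => uU; apply: noP; exists u.
apply: (IH (U + <[v]>)%VS); first exact: PD'.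
have lt := dim_add_line vU.
move: dU; rewrite leq_subLR => dU; rewrite leq_subLR.
by rewrite (leq_trans dU) // addnS -addSn leq_add2r.
Qed.

End LinearAlgebra.

(** * Homogeneous ideals and regular sequences of linear forms *)

Section Ideals.
Variables (K : numClosedFieldType) (n : nat).
Local Notation V := {mpoly K[n.+1]}.
Local Notation pi := (pihomog mdeg).
Implicit Types (J : V -> Prop) (s : seq V) (f g h t x y : V).

Record homogeneous_ideal J : Prop := HomogeneousIdeal {
  hid0 : J 0;
  hidD : forall f g, J f -> J g -> J (f + g);
  hidM : forall f g, J g -> J (f * g);
  hidH : forall d f, J f -> J (pi d f) }.

Definition addl J t f := exists g h, J g /\ f = g + t * h.
Definition adds J s := foldl addl J s.
Definition reg J t := forall f, J (t * f) -> J f.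
(** Regularity in the weak sense: the final quotient may be zero. Thus every sequence is regular
    modulo the unit ideal, which stands in for the contraction in the parallel case. *)
Fixpoint regs J s :=
  if s is t :: s' then reg J t /\ regs (addl J t) s' else True.
Definition linear_forms s := all (fun t => t \is 1.-homog) s.
Definition spans J N := forall f, f \is N.-homog -> J f.

Lemma hidN J f : homogeneous_ideal J -> J f -> J (- f).
Proof. by move=> hJ Jf; rewrite -mulN1r; apply: hidM. Qed.

Lemma hidB J f g : homogeneous_ideal J -> J f -> J g -> J (f - g).
Proof. by move=> hJ Jf Jg; apply: hidD => //; apply: hidN. Qed.

Lemma hidMr J f g : homogeneous_ideal J -> J g -> J (g * f).
Proof. by move=> hJ Jg; rewrite mulrC; apply: hidM. Qed.

Lemma hidZ J c f : homogeneous_ideal J -> J f -> J (c *: f).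
Proof. by move=> hJ Jf; rewrite -mul_mpolyC; apply: hidM. Qed.

Lemma hid_sum J (I : Type) (r : seq I) (P : pred I) (F : I -> V) :
  homogeneous_ideal J -> (forall i, P i -> J (F i)) -> J (\sum_(i <- r | P i) F i).
Proof.
by move=> hJ JF; apply: big_ind => //; [apply: hid0 | apply: hidD].
Qed.

Lemma pihomog_sum f : exists k, f = \sum_(d < k) pi d f.
Proof. by exists (mmeasure mdeg f); apply: pihomog_partitionE. Qed.

Lemma hid_pihomog J f :
  homogeneous_ideal J -> (forall d, J (pi d f)) -> J f.
Proof.
by move=> hJ Jf; have [k ->] := pihomog_sum f; apply: hid_sum.
Qed.

Lemma pihomog_mul_homog e t h d : t \is e.-homog ->
  pi (e + d)%N (t * h) = t * pi d h.
Proof.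
move=> ta; have [k hk] := pihomog_sum h.
rewrite {1}hk mulr_sumr raddf_sum /=.
have [dk|kd] := ltnP d k; last first.
  rewrite (_ : pi d h = 0) ?mulr0 ?big1 // => [i _|].
    rewrite (@pihomog_ne0 _ _ _ (e + i)%N) ?dhomogM ?pihomogP //.
    by have := ltn_ord i; lia.
  rewrite hk raddf_sum /= big1 // => i _.
  by rewrite (@pihomog_ne0 _ _ _ i) ?pihomogP //; have := ltn_ord i; lia.
rewrite (bigD1 (Ordinal dk)) //= pihomog_dE ?dhomogM ?pihomogP //.
rewrite big1 ?addr0 // => i id.
rewrite (@pihomog_ne0 _ _ _ (e + i)%N) ?dhomogM ?pihomogP //.
by rewrite eqn_add2l.
Qed.

Lemma pihomog_mul_linear0 t h : t \is 1.-homog -> pi 0 (t * h) = 0.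
Proof.
move=> t1; have [k {1}->] := pihomog_sum h.
rewrite mulr_sumr raddf_sum /= big1 // => i _.
by rewrite (@pihomog_ne0 _ _ _ (1 + i)%N) ?dhomogM ?pihomogP.
Qed.

Lemma addl_hid J t :
  homogeneous_ideal J -> t \is 1.-homog -> homogeneous_ideal (addl J t).
Proof.
move=> hJ t1; split.
- by exists 0, 0; rewrite mulr0 addr0; split => //; apply: hid0.
- move=> _ _ [g [h [Jg ->]]] [g' [h' [Jg' ->]]].
  by exists (g + g'), (h + h'); split; [apply: hidD | ring].
- move=> f _ [g [h [Jg ->]]].
  by exists (f * g), (f * h); split; [apply: hidM | ring].
- move=> d _ [g [h [Jg ->]]]; rewrite raddfD /=; case: d => [|d].
    exists (pi 0 g), 0; split; first exact: hidH.
    by rewrite pihomog_mul_linear0 // mulr0.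
  exists (pi d.+1 g), (pi d h); split; first exact: hidH.
  by rewrite -(pihomog_mul_homog _ _ t1).
Qed.

Lemma adds_hid J s :
  homogeneous_ideal J -> linear_forms s -> homogeneous_ideal (adds J s).
Proof.
by elim: s J => //= t s IH J hJ /andP[t1 s1]; apply: IH => //; apply: addl_hid.
Qed.

Lemma sub_addl J t f : J f -> addl J t f.
Proof. by exists f, 0; rewrite mulr0 addr0. Qed.

Lemma sub_adds J s f : J f -> adds J s f.
Proof. by elim: s J => //= t s IH J Jf; apply: IH; apply: sub_addl. Qed.

Lemma addl_mul J t h : homogeneous_ideal J -> addl J t (t * h).
Proof. by move=> hJ; exists 0, h; rewrite add0r; split=> //; apply: hid0. Qed.

Lemma addlC J a b : addl (addl J a) b = addl (addl J b) a.
Proof.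
suff H x y f : addl (addl J x) y f -> addl (addl J y) x f.
  by apply: funext => f; apply: propext; split; apply: H.
move=> [_ [h [[g [h' [Jg ->]]] ->]]]; exists (g + y * h), h'; split; last by ring.
by exists g, h.
Qed.

Lemma linear_forms_rcons s t :
  linear_forms (rcons s t) = (t \is 1.-homog) && linear_forms s.
Proof. by rewrite /linear_forms all_rcons. Qed.

Lemma adds_rcons J s t : adds J (rcons s t) = addl (adds J s) t.
Proof. by rewrite /adds -cats1 foldl_cat. Qed.

Lemma adds_cons_rcons J s t : adds J (t :: s) = adds J (rcons s t).
Proof.
elim: s J => //= a s IH J.
by rewrite -[RHS]/(adds (addl J a) (rcons s t)) -IH /adds /= addlC.
Qed.

Lemma addsP J s f : homogeneous_ideal J ->
  adds J s f <-> exists g (h : nat -> V),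
    J g /\ f = g + \sum_(i < size s) s`_i * h i.
Proof.
move=> hJ; elim/last_ind: s f => [|s t IH] f.
  split=> [Jf|[g [h [Jg ->]]]]; last by rewrite big_ord0 addr0.
  by exists f, (fun=> 0); rewrite big_ord0 addr0.
rewrite adds_rcons size_rcons; split.
  move=> [_ [h0 [/IH[g [h [Jg ->]]] ->]]].
  exists g, (fun i => if i == size s then h0 else h i); split=> //.
  rewrite big_ord_recr /= nth_rcons ltnn !eqxx -addrA; congr (_ + (_ + _)).
  apply: eq_bigr => i _; rewrite nth_rcons ltn_ord; case: eqP => // e.
  by have := ltn_ord i; rewrite e ltnn.
move=> [g [h [Jg ->]]]; exists (g + \sum_(i < size s) s`_i * h i), (h (size s)).
split; first by apply/IH; exists g, h.
rewrite big_ord_recr /= nth_rcons ltnn !eqxx addrA; congr (_ + _ + _).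
by apply: eq_bigr => i _; rewrite nth_rcons ltn_ord.
Qed.

Lemma reg_homog J t : homogeneous_ideal J -> t \is 1.-homog ->
  (forall q f, f \is q.-homog -> J (t * f) -> J f) -> reg J t.
Proof.
move=> hJ t1 H f Jtf; apply: hid_pihomog => // d.
apply: (H d); first exact: pihomogP.
by rewrite -(pihomog_mul_homog _ _ t1); apply: hidH.
Qed.

Lemma addl_homog J t q f : homogeneous_ideal J -> t \is 1.-homog ->
  f \is q.+1.-homog -> addl J t f ->
  exists g h, [/\ J g, h \is q.-homog & f = g + t * h].
Proof.
move=> hJ t1 fq [g [h [Jg fE]]]; exists (pi q.+1 g), (pi q h); split.
- exact: hidH.
- exact: pihomogP.
- rewrite -(pihomog_mul_homog _ _ t1) -[LHS](pihomog_dE fq) {1}fE.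
  exact: raddfD.
Qed.

Lemma addl_homog0 J t f : homogeneous_ideal J -> t \is 1.-homog ->
  f \is 0.-homog -> addl J t f -> J f.
Proof.
move=> hJ t1 f0 [g [h [Jg fE]]].
have /(hidH hJ 0) := Jg.
have -> : g = f - t * h by rewrite fE addrK.
by rewrite raddfB /= pihomog_mul_linear0 // subr0 pihomog_dE.
Qed.

(** Regularity of [b] modulo [J] is a graded Nakayama argument: if b f is in [J], then f = g + a h
    with g in [J], and since [a] is regular b h is in [J] with [h] of smaller degree. *)
Lemma reg_swap J a b : homogeneous_ideal J -> a \is 1.-homog -> b \is 1.-homog ->
  reg J a -> reg (addl J a) b -> reg J b /\ reg (addl J b) a.
Proof.
move=> hJ a1 b1 rA rB; have rb : reg J b.
  apply: reg_homog => //; elim=> [|q IH] f fq Jbf.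
    by apply: (addl_homog0 hJ a1 fq); apply: rB; apply: sub_addl.
  have /rB : addl J a (b * f) by apply: sub_addl.
  case/(addl_homog hJ a1 fq) => g [h [Jg hq fE]].
  rewrite fE; apply: hidD => //; apply: hidM => //; apply: IH => //; apply: rA.
  have -> : a * (b * h) = b * f - b * g by rewrite fE; ring.
  by apply: hidB => //; apply: hidM.
split=> // f [g [h [Jg afE]]].
have [g' [h' [Jg' hE]]] : addl J a h.
  apply: rB; exists (- g), f; split; first exact: hidN.
  by rewrite afE addKr.
exists (f - b * h'), h'; split; last by rewrite subrK.
apply: rA; have -> : a * (f - b * h') = g + b * g'.
  by rewrite mulrBr afE hE; ring.
by apply: hidD => //; apply: hidM.
Qed.

Lemma regs_rotate J s t : homogeneous_ideal J -> t \is 1.-homog ->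
  linear_forms s -> regs J (t :: s) <-> regs J (rcons s t).
Proof.
elim: s J => // a s IH J hJ t1 /= /andP[a1 s1].
rewrite -IH //=; last exact: addl_hid.
rewrite (addlC _ t a); split=> -[r1 [r2 r3]].
  by have [] := reg_swap hJ t1 a1 r1 r2.
by have [] := reg_swap hJ a1 t1 r1 r2.
Qed.

Lemma regs_rcons J s t : regs J (rcons s t) <-> regs J s /\ reg (adds J s) t.
Proof.
elim: s J => [|a s IH] J /=; first by split=> -[].
by rewrite IH; split=> [[? []]|[[]]].
Qed.

Lemma spansS J N : homogeneous_ideal J -> spans J N -> spans J N.+1.
Proof.
move=> hJ sJ f fN; rewrite [f]mpolyE big_seq; apply: hid_sum => // m mf.
apply: hidZ => //.
have dm : mdeg m = N.+1 by apply: (dhomog_mf fN).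
have [i mi] : exists i, (0 < m i)%N.
  apply/existsP; rewrite -[[exists _, _]]negbK negb_exists; apply/negP => /forallP m0.
  suff : mdeg m = 0%N by rewrite dm.
  by rewrite mdegE big1 // => i _; have := m0 i; lia.
have mE : m = (U_(i) + (m - U_(i)))%MM.
  by rewrite addmC submK // lep1mP -lt0n.
rewrite mE mpolyXD; apply: hidM => //; apply: sJ; rewrite dhomogX.
by move/(congr1 mdeg): mE; rewrite mdegD mdeg1 dm; move=> /eqP; rewrite eqSS eq_sym.
Qed.

Lemma spans_le J N M : homogeneous_ideal J -> (N <= M)%N -> spans J N -> spans J M.
Proof.
move=> hJ /subnK <-; elim: (M - N)%N => // k IH sJ.
by rewrite addSn; apply: spansS => //; apply: IH.
Qed.

End Ideals.

(** The hypothesis makes [m] induce an injection from A/H to B/G, whose cokernel is B/(G + im m). *)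
Lemma codim_quotient_map (K : fieldType) (A B : vectType K) (m : 'Hom(A, B))
    (G : {vspace B}) (H : {vspace A}) :
  (forall v, (m v \in G) = (v \in H)) ->
  ((dim B - \dim (G + limg m)) + (dim A - \dim H) = dim B - \dim G)%N.
Proof.
move=> mG.
have kH : (lker m <= H)%VS.
  by apply/subvP => v; rewrite memv_ker -mG => /eqP ->; exact: mem0v.
have e1 := limg_ker_dim m H.
have e2 := limg_ker_dim m fullv.
rewrite capfv in e2; rewrite (capv_idPr kH) in e1.
have GH : (G :&: limg m = m @: H)%VS.
  apply/vspaceP => w; rewrite memv_cap; apply/andP/memv_imgP.
    by move=> [wG /memv_imgP[v _ wE]]; exists v; rewrite // -mG -wE.
  by move=> [v vH ->]; rewrite mG vH memv_img ?memvf.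
have e3 := dimv_sum_cap G (limg m); rewrite GH in e3.
have h1 := dimvS (subvf (G + limg m)); have h2 := dimvS (subvf H).
rewrite !dimvf in h1 h2 e2.
by rewrite /dim in h1 h2 e2 *; lia.
Qed.

Lemma eq_of_codim (K : fieldType) (A : vectType K) (U W : {vspace A}) :
  (U <= W)%VS -> (dim A - \dim W = dim A - \dim U)%N -> U = W.
Proof.
move=> UW e; apply/eqP; rewrite eqEdim UW /=.
have := dimvS (subvf U); have := dimvS (subvf W).
by rewrite !dimvf; move: e; lia.
Qed.

(** * Hilbert functions *)

Section HilbertFunction.
Variables (K : numClosedFieldType) (n : nat).
Local Notation V := {mpoly K[n.+1]}.
Local Notation pi := (pihomog mdeg).
Implicit Types (J : V -> Prop) (s : seq V) (f g h t x y : V).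
Local Notation piece q := (dhomog n.+1 K q).

Lemma linear_homogM t f q :
  t \is 1.-homog -> f \is q.-homog -> t * f \is q.+1.-homog.
Proof. exact: (@dhomogM _ _ mdeg 1%N t q f). Qed.

Definition to_piece q f : piece q := DHomog (pihomogP mdeg q f).

Fact to_piece_linear q : linear (to_piece q).
Proof. by move=> c f g; apply: val_inj; rewrite /= linearP. Qed.
HB.instance Definition _ q :=
  GRing.isLinear.Build K V (piece q) *:%R (to_piece q) (to_piece_linear q).

Lemma to_pieceK q f : f \is q.-homog -> val (to_piece q f) = f.
Proof. exact: pihomog_dE. Qed.

(** The assumption on [J] stands inside the existential so that [hpiece] is defined for every
    predicate, without a proof as argument. *)
Lemma homogeneous_piece_ex J q : exists U : {vspace piece q},
  homogeneous_ideal J -> forall u, u \in U <-> J (val u).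
Proof.
have [hJ|nJ] := pselect (homogeneous_ideal J); last by exists 0%VS.
have [||U UP] := @exists_vspace K (piece q) (fun u => J (val u)).
- by rewrite linear0; apply: hid0.
- move=> c u v Ju Jv; rewrite linearP; apply: hidD => //; exact: hidZ.
- by exists U.
Qed.

Definition hpiece J q : {vspace piece q} := projT1 (cid (homogeneous_piece_ex J q)).

Lemma hpieceP J q u : homogeneous_ideal J -> u \in hpiece J q <-> J (val u).
Proof. by move=> hJ; apply: (projT2 (cid (homogeneous_piece_ex J q))). Qed.

Definition hf J q := (dim (piece q) - \dim (hpiece J q))%N.

Definition mul_piece t q (u : piece q) : piece q.+1 := to_piece q.+1 (t * val u).

Fact mul_piece_linear t q : linear (@mul_piece t q).
Proof.
by move=> c u v; rewrite /mul_piece !linearP /= mulrDr -scalerAr linearP.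
Qed.
HB.instance Definition _ t q :=
  GRing.isLinear.Build K (piece q) (piece q.+1) *:%R (@mul_piece t q)
    (@mul_piece_linear t q).

Definition mulp t q : 'Hom(piece q, piece q.+1) := linfun (@mul_piece t q).

Lemma mulpE t q u : t \is 1.-homog -> val (mulp t q u) = t * val u.
Proof.
by move=> t1; rewrite lfunE /= pihomog_dE //; exact: linear_homogM (dhomog_is_dhomog u).
Qed.

Lemma hpiece_sub J J' q : homogeneous_ideal J -> homogeneous_ideal J' ->
  (forall f, f \is q.-homog -> J f -> J' f) -> (hpiece J q <= hpiece J' q)%VS.
Proof.
move=> hJ hJ' JJ'; apply/subvP => u /(hpieceP _ hJ) Ju.
by apply/(hpieceP _ hJ'); exact: JJ' (dhomog_is_dhomog u) Ju.
Qed.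

Lemma hpiece_addl J t q : homogeneous_ideal J -> t \is 1.-homog ->
  hpiece (addl J t) q.+1 = (hpiece J q.+1 + limg (mulp t q))%VS.
Proof.
move=> hJ t1; have hJt := addl_hid hJ t1; apply/eqP; rewrite eqEsubv; apply/andP; split.
  apply/subvP => u /(hpieceP _ hJt) /(addl_homog hJ t1 (valP u)) [g [h [Jg hq uE]]].
  have -> : u = to_piece q.+1 g + mulp t q (to_piece q h).
    apply: val_inj; rewrite raddfD /= mulpE // to_pieceK // pihomog_dE //.
    have -> : g = val u - t * h by rewrite uE addrK.
    by rewrite dhomogD ?dhomogN ?(valP u) ?linear_homogM.
  apply: memv_add; last by rewrite memv_img ?memvf.
  by apply/hpieceP => //; apply: hidH.
rewrite subv_add; apply/andP; split.
  by apply: hpiece_sub => // f _; apply: sub_addl.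
apply/subvP => _ /memv_imgP[u _ ->]; apply/(hpieceP _ hJt).
by rewrite mulpE //; apply: addl_mul.
Qed.

Lemma hf_full J q : homogeneous_ideal J -> spans J q <-> hf J q = 0%N.
Proof.
move=> hJ; rewrite /hf; split=> [sJ|/eqP d0 f fq].
  suff -> : hpiece J q = fullv by rewrite dimvf subnn.
  by apply/vspaceP => u; rewrite memvf; apply/(hpieceP _ hJ); exact: sJ (valP u).
have : hpiece J q == fullv by rewrite eqEdim subvf dimvf -subn_eq0.
move/eqP => JF; have := memvf (to_piece q f).
by rewrite -JF => /(hpieceP _ hJ); rewrite to_pieceK.
Qed.

Lemma hf_ne0 J q : homogeneous_ideal J -> ~ spans J q -> (0 < hf J q)%N.
Proof. by move=> hJ nJ; rewrite lt0n; apply/eqP => /(hf_full _ hJ). Qed.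

Lemma hf_reg J t q : homogeneous_ideal J -> t \is 1.-homog ->
  (forall f, f \is q.-homog -> J (t * f) -> J f) ->
  (hf (addl J t) q.+1 + hf J q = hf J q.+1)%N.
Proof.
move=> hJ t1 tJ; rewrite {1}/hf hpiece_addl //; apply: codim_quotient_map => u.
apply/idP/idP => /(hpieceP _ hJ) Ju; apply/(hpieceP _ hJ).
  by rewrite mulpE // in Ju; apply: tJ Ju; exact: valP.
by rewrite mulpE //; apply: hidM.
Qed.

Lemma hf_addl0 J t : homogeneous_ideal J -> t \is 1.-homog ->
  hf (addl J t) 0 = hf J 0.
Proof.
move=> hJ t1; rewrite /hf; congr (_ - \dim _)%N; have hJt := addl_hid hJ t1.
apply/eqP; rewrite eqEsubv; apply/andP; split; apply: hpiece_sub => // f f0.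
  exact: addl_homog0 f0.
exact: sub_addl.
Qed.

Lemma hf_adds0 (J : V -> Prop) s : homogeneous_ideal J -> linear_forms s -> hf (adds J s) 0 = hf J 0.
Proof.
elim: s J => //= t s IH J hJ /andP[t1 s1].
by rewrite -[adds _ _]/(adds (addl J t) s) IH ?hf_addl0 //; apply: addl_hid.
Qed.

(** Here multiplication by [t] is onto from degree q to q + 1 modulo [J], so dimensions cannot grow,
    and equal dimensions force injectivity. *)
Lemma hf_surj J t q : homogeneous_ideal J -> t \is 1.-homog ->
  spans (addl J t) q.+1 -> (hf J q.+1 <= hf J q)%N /\
  (hf J q.+1 = hf J q -> forall f, f \is q.-homog -> J (t * f) -> J f).
Proof.
move=> hJ t1 sJ.
pose H := (mulp t q @^-1: hpiece J q.+1)%VS.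
have HP u : (mulp t q u \in hpiece J q.+1) = (u \in H) by rewrite memv_preim.
have e := codim_quotient_map HP.
have hJt := addl_hid hJ t1.
move: (sJ) => /(hf_full _ hJt); rewrite /hf hpiece_addl // => e0.
rewrite e0 add0n in e.
have JH : (hpiece J q <= H)%VS.
  apply/subvP => u /(hpieceP _ hJ) Ju; rewrite -HP; apply/(hpieceP _ hJ).
  by rewrite mulpE //; apply: hidM.
have dJH := dimvS JH; split; first by rewrite /hf -e leq_sub2l.
rewrite /hf -e => eJ f fq Jtf.
have HE := eq_of_codim JH eJ.
rewrite -(to_pieceK fq); apply/(hpieceP _ hJ); rewrite HE -HP.
by apply/(hpieceP _ hJ); rewrite mulpE // to_pieceK.
Qed.

Lemma nonincreasing_stationary (a : nat -> nat) N :
  (forall q, (N <= q)%N -> (a q.+1 <= a q)%N) ->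
  exists2 M, (N <= M)%N & forall q, (M <= q)%N -> a q = a M.
Proof.
move: {2}(a N) (leqnn (a N)) => k; elim/ltn_ind: k N => k IH N aN dec.
have [[M NM aM]|noM] := pselect (exists2 M, (N <= M)%N & (a M < a N)%N).
  have [||M' MM' M'P] := IH (a M) _ M (leqnn _); first exact: leq_trans aN.
    by move=> q Mq; apply: dec; apply: leq_trans Mq.
  by exists M' => //; apply: leq_trans MM'.
exists N => // q /subnKC <-; elim: (q - N)%N => [|i IHi]; first by rewrite addn0.
apply/eqP; rewrite eqn_leq addnS -{1}IHi dec ?leq_addr //=.
rewrite leqNgt; apply/negP => lt; apply: noM; exists (N + i).+1 => //.
by rewrite -addnS leq_addr.
Qed.

(** Surjectivity makes the Hilbert function nonincreasing from [N] on, hence eventually constant;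
    from then on surjective means injective. *)
Lemma stationary_bijective J t N : homogeneous_ideal J -> t \is 1.-homog ->
  spans (addl J t) N ->
  exists2 M, (N <= M)%N & forall q, (M <= q)%N ->
    forall f, f \is q.-homog -> J (t * f) -> J f.
Proof.
move=> hJ t1 sJ; have hJt := addl_hid hJ t1.
have sq q : (N <= q)%N -> spans (addl J t) q.+1.
  by move=> Nq; apply: (spans_le hJt) sJ; apply: leqW.
have [|M NM MP] := @nonincreasing_stationary (hf J) N.
  by move=> q /sq; case/(hf_surj hJ t1).
exists M => // q Mq; have /sq := leq_trans NM Mq.
by case/(hf_surj hJ t1) => _; apply; rewrite !MP // leqW.
Qed.

Lemma reg_exp J x k f : reg J x -> J (x ^+ k * f) -> J f.
Proof.
move=> rx; elim: k => [|k IH]; first by rewrite expr0 mul1r.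
by rewrite exprS -mulrA => /rx.
Qed.

(* For large degrees multiplication by y is an isomorphism modulo J, so its
   kernel modulo J is killed by a power of the regular element x. *)
Lemma reg_of_spans J x y N : homogeneous_ideal J ->
  x \is 1.-homog -> y \is 1.-homog -> reg J x -> spans (addl J y) N -> reg J y.
Proof.
move=> hJ x1 y1 rx sy; have [M _ MP] := stationary_bijective hJ y1 sy.
apply: reg_homog => // q f fq Jyf.
apply: (reg_exp (k := M) rx); apply: (MP (M + q)%N); first exact: leq_addr.
  by apply: dhomogM => //; have := dhomogMn M x1; rewrite mul1n.
have -> : y * (x ^+ M * f) = x ^+ M * (y * f) by ring.
exact: hidM.
Qed.

Definition pencil s s' (c : K) := [seq p.1 + c *: p.2 | p <- zip s s'].

Lemma size_pencil s s' c : size s = size s' -> size (pencil s s' c) = size s.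
Proof. by move=> e; rewrite size_map size_zip e minnn. Qed.

Lemma nth_pencil s s' c i : size s = size s' -> (i < size s)%N ->
  (pencil s s' c)`_i = s`_i + c *: s'`_i.
Proof.
move=> e i_s; rewrite (nth_map (0, 0)) ?size_zip -?e ?minnn //.
by rewrite nth_zip.
Qed.

Lemma linear_forms_pencil s s' c :
  linear_forms s -> linear_forms s' -> linear_forms (pencil s s' c).
Proof.
rewrite /linear_forms /pencil; elim: s s' => [|t s IH] [|t' s'] //=.
by move=> /andP[t1 s1] /andP[t1' s1']; rewrite rpredD ?rpredZ //=; apply: IH.
Qed.

(** Write each [e] of degree [N] as an element of [J] plus a combination of [s], with coefficients
    linear in [e], and let [C] replace [s] by [s'] in it. Then e + c C e lies in the ideal of the
    pencil, and these elements fill degree [N] for almost all [c]. *)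
Lemma spans_pencil J s s' N : homogeneous_ideal J ->
  linear_forms s -> linear_forms s' -> size s = size s' ->
  spans (adds J s) N ->
  exists bad : seq K, forall c, c \notin bad -> spans (adds J (pencil s s' c)) N.
Proof.
move=> hJ s1 s1' ss sJ.
pose Rel (e e' : piece N) := exists g (h : nat -> V), J g /\
  (val e = g + \sum_(i < size s) s`_i * h i /\
   val e' = pi N (\sum_(i < size s) s'`_i * h i)).
have [||e|C CP] := @linear_relation_graph K (piece N) (piece N) Rel.
- move=> c e e' f f' [g [h [Jg [eE fE]]]] [g' [h' [Jg' [eE' fE']]]].
  exists (c *: g + g'), (fun i => c *: h i + h' i); split.
    by apply: hidD => //; apply: hidZ.
  have sumP s0 : \sum_(i < size s) s0`_i * (c *: h i + h' i) =
      c *: (\sum_(i < size s) s0`_i * h i) + \sum_(i < size s) s0`_i * h' i.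
    rewrite scaler_sumr -big_split /=; apply: eq_bigr => i _.
    by rewrite mulrDr scalerAr.
  split; rewrite sumP [LHS]linearP /=; first by rewrite eE eE' scalerDr addrACA.
  by rewrite fE fE' linearP.
- exists 0, (fun=> 0); split; first exact: hid0.
  by split; rewrite big1 ?linear0 ?addr0 // => i _; rewrite mulr0.
- have /(addsP _ _ hJ) [g [h [Jg eE]]] := sJ _ (valP e).
  by exists (to_piece N (\sum_(i < size s) s'`_i * h i)), g, h.
have [bad badP] := end_pencil C; exists bad => c /badP surj f fN.
have hJp := adds_hid hJ (linear_forms_pencil c s1 s1').
have [u uE] := surj (to_piece N f).
rewrite -(to_pieceK fN) -uE.
have -> : val (u + c *: C u) = val u + c *: val (C u) by [].
have [g [h [Jg [eE ->]]]] := CP u.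
rewrite -(pihomog_dE (valP u)) eE -linearZ -raddfD /=; apply: hidH => //.
rewrite -addrA; apply/(addsP _ _ hJ); exists g, h; split => //; congr (_ + _).
rewrite size_pencil // scaler_sumr -big_split /=; apply: eq_bigr => i _.
by rewrite nth_pencil // mulrDl scalerAl.
Qed.

End HilbertFunction.

Lemma exists_notin (K : numDomainType) (s : seq K) : exists c, c \notin s.
Proof.
exists (1 + \sum_(x <- s) `|x|); apply/negP => cs.
have : `|1 + \sum_(x <- s) `|x| | <= \sum_(x <- s) `|x|.
  by rewrite [leRHS](big_rem _ cs) /= lerDl sumr_ge0.
rewrite ger0_norm ?addr_ge0 ?sumr_ge0 //.
by rewrite -lerBrDr subrr ler10.
Qed.

(** * Exchange of regular sequences along generic pencils *)

Section Exchange.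
Variables (K : numClosedFieldType) (n : nat).
Local Notation V := {mpoly K[n.+1]}.
Local Notation pi := (pihomog mdeg).
Implicit Types (J : V -> Prop) (s : seq V) (f g h t x y : V).
Local Notation piece q := (dhomog n.+1 K q).

Lemma adds_scale J s (c : K) : c != 0 -> adds J [seq c *: t | t <- s] = adds J s.
Proof.
move=> c0; elim: s J => //= t s IH J.
rewrite -[LHS]/(adds (addl J (c *: t)) [seq c *: t | t <- s]) IH.
congr (adds _ s); apply: funext => f; apply: propext.
split=> [[g [h [Jg ->]]]|[g [h [Jg ->]]]].
  by exists g, (c *: h); rewrite -scalerAr -scalerAl.
by exists g, (c^-1 *: h); split=> //; rewrite -scalerAr -scalerAl scalerA mulVf ?scale1r.
Qed.

(** The two pencils differ by the unit [c]. So one pencil can be read as a generic perturbation of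
    either end. *)
Lemma spans_pencil_swap J s s' (c : K) N : size s = size s' -> c != 0 ->
  spans (adds J (pencil s' s c^-1)) N -> spans (adds J (pencil s s' c)) N.
Proof.
move=> ss c0; rewrite -(adds_scale _ _ c0); congr (spans (adds _ _) N).
apply: (@eq_from_nth _ 0); rewrite size_map !size_pencil // => i i_s.
rewrite (nth_map 0) ?size_pencil // !nth_pencil //; last by rewrite ss.
by rewrite scalerDr scalerA divff // scale1r addrC.
Qed.

(* Put z = xs + c ys for a generic c, so that both x :: z and y :: z still span.
   Regularity passes from x :: xs to x :: z to y :: z to y :: ys: the outer
   steps are the induction hypothesis modulo x and y, and the middle one is
   reg_of_spans modulo z. *)
Lemma regs_exchange J s s' N : homogeneous_ideal J ->
  linear_forms s -> linear_forms s' -> size s = size s' ->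
  regs J s -> spans (adds J s) N -> spans (adds J s') N -> regs J s'.
Proof.
move: {2}(size s) (leqnn (size s)) => k.
elim: k s s' J => [|k IH] [|x s] [|y s'] J //= sk hJ /andP[x1 s1] /andP[y1 s1'] [ss].
rewrite ltnS in sk; move=> [rx rs] sx sy.
have hJx := addl_hid hJ x1; have hJy := addl_hid hJ y1.
have [bad1 badP1] := spans_pencil hJx s1 s1' ss sx.
have [bad2 badP2] := spans_pencil hJy s1' s1 (esym ss) sy.
have [c] := exists_notin (0 :: bad1 ++ [seq d^-1 | d <- bad2]).
rewrite inE mem_cat !negb_or => /and3P[c0 cb1 cb2].
set z := pencil s s' c.
have z1 : linear_forms z by apply: linear_forms_pencil.
have sz : size z = size s by apply: size_pencil.
have zx := badP1 c cb1; rewrite -/z in zx.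
have zy : spans (adds (addl J y) z) N.
  have c'b : c^-1 \notin bad2.
    by apply: contra cb2 => cb; apply/mapP; exists c^-1; rewrite ?invrK.
  exact: spans_pencil_swap (badP2 _ c'b).
have rz : regs (addl J x) z by apply: (IH s z _ sk hJx).
have : regs J (x :: z) by [].
rewrite (regs_rotate hJ x1 z1) regs_rcons => -[rJz _].
have hJz := adds_hid hJ z1.
have rzx : reg (adds J z) x.
  have : regs J (x :: z) by [].
  by rewrite (regs_rotate hJ x1 z1) regs_rcons => -[].
have rzy : reg (adds J z) y.
  apply: (reg_of_spans hJz x1 y1 rzx (N := N)).
  by rewrite -adds_rcons -adds_cons_rcons.
have [ry rzs] : regs J (y :: z).
  by rewrite (regs_rotate hJ y1 z1) regs_rcons.
by split=> //; apply: (IH z) => //; rewrite sz.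
Qed.

(** Each regular form takes the first difference of the Hilbert function, so only the number of
    forms matters. This carries the degree bound from one regular sequence to another. *)
Lemma hf_adds_eq J J' s s' : homogeneous_ideal J -> homogeneous_ideal J' ->
  linear_forms s -> linear_forms s' -> size s = size s' ->
  regs J s -> regs J' s' -> hf J =1 hf J' -> hf (adds J s) =1 hf (adds J' s').
Proof.
elim: s s' J J' => [|x s IH] [|y s'] J J' hJ hJ' //= /andP[x1 s1] /andP[y1 s1'] [ss].
move=> [rx rs] [ry rs'] JJ'; apply: IH => //; try exact: addl_hid.
case=> [|q]; first by rewrite !hf_addl0.
apply/eqP; rewrite -(eqn_add2r (hf J q)) {2}JJ' !hf_reg ?JJ' // => f _.
  exact: ry.
exact: rx.
Qed.

Lemma hf_const J t N : homogeneous_ideal J -> t \is 1.-homog -> reg J t ->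
  spans (addl J t) N.+1 -> forall q, (N <= q)%N -> hf J q = hf J N.
Proof.
move=> hJ t1 rt st q /subnKC <-; elim: (q - N)%N => [|k IH]; first by rewrite addn0.
have := hf_reg (q := (N + k)%N) hJ t1 (fun f _ => rt f).
rewrite addnS IH => <-; have hJt := addl_hid hJ t1.
have /(hf_full _ hJt) -> // : spans (addl J t) (N + k).+1.
by apply: spans_le st => //; rewrite ltnS leq_addr.
Qed.

End Exchange.

(** * The projective Nullstellensatz *)

Section Nullstellensatz.
Variables (K : numClosedFieldType) (n : nat).
Local Notation V := {mpoly K[n.+1]}.
Local Notation pi := (pihomog mdeg).
Implicit Types (J : V -> Prop) (s : seq V) (f g h t x y : V).
Local Notation piece q := (dhomog n.+1 K q).

Lemma homog_var (i : 'I_n.+1) : ('X_i : V) \is 1.-homog.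
Proof. by rewrite dhomogX; apply/eqP/mdeg1. Qed.

Lemma hf_lt J J' q f : homogeneous_ideal J -> homogeneous_ideal J' ->
  (forall g, J g -> J' g) -> f \is q.-homog -> J' f -> ~ J f ->
  (hf J' q < hf J q)%N.
Proof.
move=> hJ hJ' JJ' fq J'f nJf.
have sub := hpiece_sub (q := q) hJ hJ' (fun g _ => JJ' g).
rewrite ltn_neqAle /hf leq_sub2l ?dimvS // andbT; apply/eqP => e.
apply: nJf; rewrite -(to_pieceK fq); apply/(hpieceP _ hJ).
by rewrite (eq_of_codim sub e); apply/(hpieceP _ hJ'); rewrite to_pieceK.
Qed.

(* In large degrees x is bijective on the graded pieces, hence x^-1 t has an
   eigenvalue c there; t - c x is then a zero divisor in all larger degrees,
   which is impossible for a form outside J. *)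
Lemma linear_forms_proportional J x t : homogeneous_ideal J ->
  (forall N, ~ spans J N) ->
  (forall y, y \is 1.-homog -> ~ J y -> exists N, spans (addl J y) N) ->
  x \is 1.-homog -> ~ J x -> t \is 1.-homog -> exists c : K, J (t - c *: x).
Proof.
move=> hJ nJ fin x1 nx t1.
have [N sx] := fin x x1 nx.
have [M NM xinj] := stationary_bijective hJ x1 sx.
have [w wJ] : exists w : piece M, w \notin hpiece J M.
  have := hf_ne0 hJ (nJ M); rewrite /hf subn_gt0 => lt.
  apply: contrapT => /forallNP all; move: lt; suff -> : hpiece J M = fullv by rewrite dimvf ltnn.
  by apply/vspaceP => u; rewrite memvf; apply: contrapT => /negP; apply: all.
pose D := (hpiece J M)^C%VS.
have decomp u : exists2 d, d \in D & u - d \in hpiece J M.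
  have : u \in (hpiece J M + D)%VS by rewrite addv_complf memvf.
  by case/memv_addP => a aJ [d dD ->]; exists d => //; rewrite addrK.
have [d dD dw] := decomp w.
have d0 : d != 0 by apply: contraNneq wJ => d0; move: dw; rewrite d0 subr0.
have hJx := addl_hid hJ x1.
have surj e : exists2 f, f \in D & e - mulp x M f \in hpiece J M.+1.
  have /(addl_homog hJ x1 (valP e)) [g [h [Jg hM eE]]] : addl J x (val e).
    by apply: (spans_le hJx _ sx (valP e)); apply: leqW.
  have [f fD hf'] := decomp (to_piece M h); exists f => //.
  apply/(hpieceP _ hJ).
  have -> : val (e - mulp x M f) = g + x * val (to_piece M h - f).
    by rewrite !raddfB /= mulpE // pihomog_dE // eE; ring.
  by apply: hidD => //; apply: hidM => //; apply/(hpieceP _ hJ).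
have [c [f [fD f0 fJ]]] := pencil_eigen (mulp t M) dD d0 surj.
exists c; apply: contrapT => nc.
have tc1 : t - c *: x \is 1.-homog by rewrite dhomogD ?dhomogN ?dhomogZ.
have [N' sc] := fin _ tc1 nc.
have [M' _ cinj] := stationary_bijective hJ tc1 sc.
have nf : ~ J (val f).
  move/(hpieceP _ hJ) => fJ'; have : f \in (hpiece J M :&: D)%VS.
    by rewrite memv_cap fJ'.
  by rewrite capv_compl memv0 (negPf f0).
apply: nf.
(* The degree [M] of [f] may lie below the range where t - c x is injective; [f] is raised by a
   power of [x], and the power is stripped afterwards because [x] is injective from degree [M]
   on. *)
have xMf : x ^+ M' * val f \is (M' + M).-homog.
  by apply: dhomogM (valP f); have := dhomogMn M' x1; rewrite mul1n.
have : J (x ^+ M' * val f).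
  apply: (cinj _ (leq_addr M M') _ xMf).
  have -> : (t - c *: x) * (x ^+ M' * val f) =
      x ^+ M' * (t * val f - c *: (x * val f)) by rewrite scalerAl; ring.
  apply: hidM => //; move/(hpieceP _ hJ): fJ.
  by rewrite -!mulpE.
elim: M' {cinj xMf} => [|k IH]; first by rewrite expr0 mul1r.
rewrite exprS -mulrA => Jxx; apply: IH; apply: (xinj (k + M)%N) Jxx.
  exact: leq_addl.
by apply: dhomogM (valP f); have := dhomogMn k x1; rewrite mul1n.
Qed.

Lemma meval_homogZ d (c : K) (v : 'I_n.+1 -> K) f : f \is d.-homog ->
  f.@[fun i => c * v i] = c ^+ d * f.@[v].
Proof.
move=> fd; rewrite !mevalE mulr_sumr; apply: eq_big_seq => m mf.
have dm : mdeg m = d := dhomog_mf fd mf.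
rewrite -dm mdegE -prodrXr mulrCA; congr (_ * _).
by rewrite -big_split /=; apply: eq_bigr => i _; rewrite exprMn.
Qed.

(** Linear forms are adjoined to [J] as long as the quotient keeps infinite length, which lowers its
    dimension in degree 1. At the end every variable is congruent to a multiple v_i x of one form
    [x], so a form [f] of degree k is congruent to f(v) x^k. If f(v) were nonzero for some [f] in
    [J], then x^k and with it all of degree k would lie in [J]. *)
Lemma proj_nullstellensatz J : homogeneous_ideal J ->
  (forall N, ~ spans J N) ->
  exists2 v : 'rV[K]_n.+1, v != 0 &
    forall k f, f \is k.-homog -> J f -> f.@[v 0] = 0.
Proof.
move: {2}(hf J 1) (leqnn (hf J 1)) => k; elim: k J => [|k IH] J hk hJ nJ.
  by case: (nJ 1%N); apply/(hf_full _ hJ)/eqP; rewrite -leqn0.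
have [[t [t1 nt st]]|fin] := pselect (exists t,
    [/\ t \is 1.-homog, ~ J t & forall N, ~ spans (addl J t) N]).
  have hJt := addl_hid hJ t1.
  have [|v v0 vP] := IH (addl J t) _ hJt st.
    rewrite -ltnS (leq_trans _ hk) // (hf_lt hJ hJt _ t1) //; last first.
      by have := addl_mul t 1 hJ; rewrite mulr1.
    by move=> g; apply: sub_addl.
  by exists v => // d f fd Jf; apply: (vP d) => //; apply: sub_addl.
have {}fin y : y \is 1.-homog -> ~ J y -> exists N, spans (addl J y) N.
  by move=> y1 ny; apply: contrapT => /forallNP nN; apply: fin; exists y.
have [x [x1 nx]] : exists x, x \is 1.-homog /\ ~ J x.
  apply: contrapT => nx; apply: (nJ 1%N) => f f1.
  by apply: contrapT => nf; apply: nx; exists f.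
have [v vP] := boolp.choice (fun i : 'I_n.+1 =>
  linear_forms_proportional hJ nJ fin x1 nx
    (homog_var i)).
have mulP a a' b b' : J (a - a') -> J (b - b') -> J (a * b - a' * b').
  move=> Ja Jb; have -> : a * b - a' * b' = b * (a - a') + a' * (b - b') by ring.
  by apply: hidD => //; apply: hidM.
have monP (m : 'X_{1..n.+1}) : J ('X_[m] - 'X_[m].@[v] *: x ^+ mdeg m).
  have -> : 'X_[m].@[v] *: x ^+ mdeg m = \prod_i (v i *: x) ^+ m i.
    rewrite mevalX mdegE -prodrXr -scaler_prod.
    by apply: eq_bigr => i _; rewrite exprZn.
  rewrite mpolyXE_id; elim/big_ind2: _ => [|a b a' b' /mulP|i _]; first 2 last.
  - elim: (m i) => [|d IHd]; first by rewrite !expr0 subrr; apply: hid0.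
    by rewrite !exprS; apply: mulP.
  - by rewrite subrr; apply: hid0.
  - exact.
have homP d f : f \is d.-homog -> J (f - f.@[v] *: x ^+ d).
  move=> fd; rewrite {1}[f]mpolyE {1}mevalE scaler_suml -sumrB big_seq.
  apply: hid_sum => // m mf; have dm : mdeg m = d := dhomog_mf fd mf.
  rewrite -dm -mevalX -scalerA -scalerBr.
  exact: hidZ.
have rowE f : f.@[(\row_i v i) 0] = f.@[v] by apply: meval_eq => i; rewrite mxE.
exists (\row_i v i).
  apply/negP => /eqP v0; apply: nx.
  have := homP _ _ x1; rewrite (_ : x.@[v] = 0) ?scale0r ?subr0 //.
  have := meval_homogZ 0 v x1; rewrite expr1 mul0r => <-; rewrite -rowE v0.
  by apply: meval_eq => i; rewrite mxE mul0r.
move=> d f fd Jf; rewrite rowE; apply/eqP; apply: contrapT => /negP fv.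
have Jx : J (x ^+ d).
  rewrite -[x ^+ d]scale1r -(mulVf fv) -scalerA; apply: hidZ => //.
  rewrite -[_ *: _](subKr f); apply: hidB => //; exact: homP.
apply: (nJ d) => g gd; rewrite -[g](subrK (g.@[v] *: x ^+ d)).
by apply: hidD => //; [apply: homP | apply: hidZ].
Qed.

End Nullstellensatz.

(** * Hilbert polynomials *)

Section BackwardDifference.
Variable F : numFieldType.
Implicit Types p : {poly F}.

(** Backward differences match [hf_reg], where the quotient in degree q + 1 has dimension HF(q + 1)
    - HF(q). *)
Definition bdiff p := p - (p \Po ('X - 1)).

Lemma bdiffXn i :
  (size ('X^i - ('X - 1) ^+ i : {poly F})%R <= i)%N /\
  ('X^(i.+1) - ('X - 1) ^+ i.+1 : {poly F})`_i = i.+1%:R.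
Proof.
have rec j : 'X^(j.+1) - ('X - 1) ^+ j.+1 =
    'X^j + ('X - 1) * ('X^j - ('X - 1) ^+ j) :> {poly F} by rewrite !exprS; ring.
have sz j : (size ('X^j - ('X - 1) ^+ j : {poly F})%R <= j)%N.
  elim: j => [|j IH]; first by rewrite !expr0 subrr size_poly0.
  rewrite rec (leq_trans (size_polyD _ _)) // geq_max size_polyXn leqnn /=.
  rewrite (leq_trans (size_polyMleq _ _)) // -[1]/(1%:P) size_XsubC /=.
  by rewrite ltnS.
split; first exact: sz.
elim: i => [|i IH].
  by rewrite rec !expr0 subrr mulr0 addr0 coef1.
rewrite rec mulrBl mul1r coefD coefXn eqxx coefB coefXM /= IH.
by rewrite [X in _ - X]nth_default ?sz // subr0 addrC natr1.
Qed.

Lemma bdiffE p : bdiff p = \sum_(i < size p) p`_i *: ('X^i - ('X - 1) ^+ i).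
Proof.
rewrite /bdiff comp_polyE -{1}(coefK p) poly_def -sumrB.
by apply: eq_bigr => i _; rewrite scalerBr.
Qed.

Lemma bdiff_const p : (size p <= 1)%N -> bdiff p = 0.
Proof.
move=> sp; rewrite bdiffE big1 // => i _.
have -> : nat_of_ord i = 0%N by have := ltn_ord i; lia.
by rewrite !expr0 subrr scaler0.
Qed.

Lemma bdiff_size p m : size p = m.+2 ->
  size (bdiff p) = m.+1 /\ lead_coef (bdiff p) = m.+1%:R * lead_coef p.
Proof.
move=> sp; have szle : (size (bdiff p) <= m.+1)%N.
  rewrite bdiffE sp (leq_trans (size_sum _ _ _)) //; apply/bigmax_leqP => i _.
  rewrite (leq_trans (size_scale_leq _ _)) // (leq_trans (bdiffXn i).1) //.
  by rewrite -ltnS.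
have cm : (bdiff p)`_m = m.+1%:R * lead_coef p.
  rewrite bdiffE sp coef_sum big_ord_recr /= big1 ?add0r => [|i _].
    by rewrite coefZ (bdiffXn m).2 /lead_coef sp mulrC.
  rewrite coefZ [X in _ * X]nth_default ?mulr0 //.
  by apply: (leq_trans (bdiffXn _).1); rewrite /= -ltnS.
have p0 : lead_coef p != 0 by rewrite lead_coef_eq0 -size_poly_eq0 sp.
have sE : size (bdiff p) = m.+1.
  apply/eqP; rewrite eqn_leq szle ltnNge; apply/negP => le.
  by move: cm; rewrite nth_default // => /esym/eqP; rewrite mulf_eq0 pnatr_eq0 (negPf p0).
by rewrite /lead_coef sE cm.
Qed.

Lemma horner_bdiff p q : (bdiff p).[q.+1%:R] = p.[q.+1%:R] - p.[q%:R].
Proof.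
rewrite /bdiff hornerD hornerN horner_comp !hornerE.
by rewrite -natr1 addrK.
Qed.

Lemma poly_eventually_const p (c : F) N :
  (forall q, (N <= q)%N -> p.[q%:R] = c) -> p = c%:P.
Proof.
move=> pc; apply: contrapT => /eqP; rewrite -subr_eq0 => r0.
have := max_poly_roots (rs := [seq q%:R | q <- iota N (size (p - c%:P))]) r0.
rewrite size_map size_iota ltnn => lt; suff : false by []; apply: lt.
  apply/allP => _ /mapP[q + ->]; rewrite mem_iota => /andP[Nq _].
  by rewrite /root hornerD hornerN hornerC pc // subrr.
by rewrite map_inj_uniq ?iota_uniq //; apply: mulrIn; apply: oner_neq0.
Qed.

End BackwardDifference.

(** Every form of [s] replaces [P] by its backward difference, until the constant [c] remains. As
    [c] is nonzero, no difference has vanished on the way, so the degree of [P] is the length of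
    [s], and the successive leading factors multiply to the factorial. *)
Lemma hilbert_polynomial_lead (K : numClosedFieldType) (n : nat)
    (J : {mpoly K[n.+1]} -> Prop) s (P : {poly rat}) N M c :
  homogeneous_ideal J -> linear_forms s -> regs J s ->
  (forall q, (N <= q)%N -> P.[q%:R] = (hf J q)%:R) ->
  (forall q, (M <= q)%N -> hf (adds J s) q = c) -> (0 < c)%N ->
  size P = (size s).+1 /\ (size s)`!%:R * lead_coef P = c%:R.
Proof.
elim: s J P N => [|t s IH] J P N hJ /=.
  move=> _ _ PJ Jc c0.
  have -> : P = c%:R%:P.
    apply: (poly_eventually_const (N := maxn N M)) => q.
    by rewrite geq_max => /andP[Nq Mq]; rewrite PJ // Jc.
  by rewrite size_polyC pnatr_eq0 -lt0n c0 lead_coefC fact0 mul1r.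
move=> /andP[t1 s1] [rt rs] PJ Jc c0.
have [|sQ lQ] := IH (addl J t) (bdiff P) N.+1 (addl_hid hJ t1) s1 rs _ Jc c0.
  case=> // q; rewrite ltnS => Nq.
  rewrite horner_bdiff !PJ // 1?leqW // -(hf_reg (q := q) hJ t1 (fun f _ => rt f)).
  by rewrite natrD addrK.
have [sP|] := leqP (size P) 1%N; first by rewrite bdiff_const // size_poly0 in sQ.
move=> sP; have [m mP] : exists m, size P = m.+2.
  by exists (size P).-2; case: (size P) sP => [|[]].
have [sz lz] := bdiff_size mP.
have ms : m = size s by move: sQ; rewrite sz => -[].
rewrite mP ms; split=> //.
by rewrite -lQ lz ms factS natrM mulrCA mulrA.
Qed.

(** * Expansion along one variable *)

Section KillVariable.
Variables (K : numClosedFieldType) (n : nat) (j : 'I_n.+1).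
Local Notation V := {mpoly K[n.+1]}.
Local Notation pi := (pihomog mdeg).
Local Notation y := ('X_j : V).
Implicit Types (J : V -> Prop) (s : seq V) (f g h t x : V).

Definition kill_var f : V := f \mPo [tuple if i == j then 0 else 'X_i | i < n.+1].
(** Absence of the variable is encoded as invariance under setting it to 0, so that closure
    properties follow from [kill_var] being a ring morphism. *)
Definition var_free f := kill_var f = f.

Lemma kill_varD f g : kill_var (f + g) = kill_var f + kill_var g.
Proof. exact: raddfD. Qed.
Lemma kill_varB f g : kill_var (f - g) = kill_var f - kill_var g.
Proof. exact: raddfB. Qed.
Lemma kill_varM f g : kill_var (f * g) = kill_var f * kill_var g.
Proof. exact: rmorphM. Qed.
Lemma kill_varZ c f : kill_var (c *: f) = c *: kill_var f.
Proof. exact: linearZ. Qed.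

Lemma kill_varX (m : 'X_{1..n.+1}) :
  kill_var 'X_[m] = if m j == 0%N then 'X_[m] else 0.
Proof.
rewrite /kill_var comp_mpolyX; case: eqP => [m0|/eqP m0].
  rewrite [RHS]mpolyXE_id; apply: eq_bigr => i _; rewrite tnth_mktuple.
  by case: eqP => // ->; rewrite m0 !expr0.
by rewrite (bigD1 j) //= tnth_mktuple eqxx expr0n (negPf m0) mul0r.
Qed.

Lemma kill_var_y : kill_var y = 0.
Proof. by rewrite kill_varX mnm1E eqxx. Qed.

Lemma kill_var_decomp f : exists f1, f = kill_var f + y * f1.
Proof.
elim/mpolyind: f => [|c m p _ _ [p1 pE]].
  by exists 0; rewrite /kill_var raddf0 mulr0 addr0.
rewrite kill_varD kill_varZ kill_varX.
have [m0|m0] := eqVneq (m j) 0%N; first by exists p1; rewrite -addrA -pE.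
exists (c *: 'X_[m - U_(j)] + p1).
rewrite scaler0 add0r mulrDr addrCA -pE; congr (_ + _).
by rewrite -scalerAr -mpolyXD addmC submK // lep1mP.
Qed.

Lemma pihomog_kill_var d f : pi d (kill_var f) = kill_var (pi d f).
Proof.
elim/mpolyind: f => [|c m p _ _ IH].
  by rewrite /kill_var !(raddf0, linear0) /=.
rewrite kill_varD kill_varZ !raddfD /= kill_varD IH; congr (_ + _).
rewrite !linearZ /= kill_varZ pihomogX; congr (_ *: _).
rewrite kill_varX; case: ifP => m0; rewrite ?linear0 ?pihomogX.
  by case: ifP => _; rewrite ?kill_varX ?m0 // /kill_var raddf0.
by case: ifP => _; rewrite ?kill_varX ?m0 // /kill_var raddf0.
Qed.

Lemma kill_var_free f : var_free (kill_var f).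
Proof.
rewrite /var_free; have [f1 fE] := kill_var_decomp f.
elim/mpolyind: f {f1 fE} => [|c m p _ _ IH]; first by rewrite /kill_var !raddf0.
rewrite kill_varD kill_varZ !(kill_varD, kill_varZ) IH; congr (_ *: _ + _).
by rewrite kill_varX; case: ifP => m0; rewrite ?kill_varX ?m0 // /kill_var raddf0.
Qed.

Lemma var_freeD f g : var_free f -> var_free g -> var_free (f + g).
Proof. by rewrite /var_free kill_varD => -> ->. Qed.
Lemma var_freeB f g : var_free f -> var_free g -> var_free (f - g).
Proof. by rewrite /var_free kill_varB => -> ->. Qed.
Lemma var_freeM f g : var_free f -> var_free g -> var_free (f * g).
Proof. by rewrite /var_free kill_varM => -> ->. Qed.
Lemma var_freeZ c f : var_free f -> var_free (c *: f).
Proof. by rewrite /var_free kill_varZ => ->. Qed.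
Lemma var_free0 : var_free 0.
Proof. exact: raddf0. Qed.
Lemma var_free_pihomog d f : var_free f -> var_free (pi d f).
Proof. by rewrite /var_free -pihomog_kill_var => ->. Qed.
Lemma homog_kill_var d f : f \is d.-homog -> kill_var f \is d.-homog.
Proof. by move=> fd; rewrite -[f](pihomog_dE fd) -pihomog_kill_var; apply: pihomogP. Qed.

Lemma kill_var_mem J f : homogeneous_ideal J -> J y -> J f -> J (kill_var f).
Proof.
move=> hJ Jy Jf; have [f1 fE] := kill_var_decomp f.
have -> : kill_var f = f - y * f1 by rewrite {2}fE addrK.
by apply: hidB => //; apply: hidMr.
Qed.

Lemma kill_var_decomp_homog q f : f \is q.+1.-homog ->
  exists2 f1, f1 \is q.-homog & f = kill_var f + y * f1.
Proof.
move=> fq; have [f1 fE] := kill_var_decomp f.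
exists (pi q f1); first exact: pihomogP.
rewrite -(pihomog_mul_homog _ _ (homog_var K j)) -[(1 + q)%N]/q.+1.
by rewrite -{1 2}(pihomog_dE fq) -pihomog_kill_var -raddfD -fE.
Qed.

Lemma kill_var_homog0 f : f \is 0.-homog -> var_free f.
Proof.
move=> f0; have [f1 fE] := kill_var_decomp f; rewrite /var_free.
have e := congr1 (pi 0) fE; rewrite raddfD /= pihomog_mul_linear0 ?homog_var // in e.
by rewrite addr0 !pihomog_dE ?homog_kill_var // in e.
Qed.

Lemma linear_subst x q f : x \is 1.-homog -> var_free x -> f \is q.-homog ->
  exists g h, [/\ var_free g, g \is q.-homog & f = g + (y - x) * h].
Proof.
move=> x1 xT; elim: q f => [|q IH] f fq.
  exists f, 0; split=> //; first exact: kill_var_homog0.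
  by rewrite mulr0 addr0.
have [f1 f1q fE] := kill_var_decomp_homog fq.
have [g [h [gT gq f1E]]] := IH f1 f1q.
exists (kill_var f + x * g), (f1 + x * h); split.
- by apply: var_freeD; [apply: kill_var_free | apply: var_freeM].
- by rewrite dhomogD ?homog_kill_var ?linear_homogM.
- by rewrite {1}fE f1E; ring.
Qed.

(** Every sufficiently large length is allowed, so that the length can be tied to that of another
    expansion. *)
Lemma var_expansion f : exists k0, forall k, (k0 <= k)%N ->
  exists2 c : nat -> V, forall i, var_free (c i) & f = \sum_(i < k.+1) y ^+ i * c i.
Proof.
elim/mpolyind: f => [|a m p _ _ [k0 IH]].
  exists 0%N => k _; exists (fun=> 0) => [i|]; first exact: var_free0.
  by rewrite big1 // => i _; rewrite mulr0.
exists (maxn (m j) k0) => k; rewrite geq_max => /andP[mk /IH[c cT pE]].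
pose m' : 'X_{1..n.+1} := (m - U_(j) *+ m j)%MM.
have mE : m = (U_(j) *+ m j + m')%MM.
  apply/mnmP => i; rewrite mnmDE mnmBE mulmnE mnm1E.
  by case: eqP => [->|]; rewrite ?mul1n ?mul0n; lia.
have m'j : m' j = 0%N by rewrite mnmBE mulmnE mnm1E eqxx mul1n subnn.
exists (fun i => c i + (if i == m j then a *: 'X_[m'] else 0)) => [i|].
  apply: var_freeD => //; case: ifP => _; last exact: var_free0.
  by apply: var_freeZ; rewrite /var_free kill_varX m'j.
under eq_bigr do rewrite mulrDr.
rewrite big_split /= -pE addrC; congr (_ + _).
rewrite (bigD1 (Ordinal (mk : (m j < k.+1)%N))) //= eqxx big1 ?addr0 => [|i].
  by rewrite {1}mE mpolyXD -mpolyXn -scalerAr.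
rewrite -val_eqE /= => /negPf ->; by rewrite mulr0.
Qed.

End KillVariable.

(** * Gluing a deletion ideal and a contraction ideal along a variable *)

Section Gluing.
Variables (K : numClosedFieldType) (n : nat) (j : 'I_n.+1).
Local Notation V := {mpoly K[n.+1]}.
Local Notation pi := (pihomog mdeg).
Local Notation y := ('X_j : V).
Local Notation T := (var_free j).
Local Notation kill := (kill_var j).
Local Notation piece q := (dhomog n.+1 K q).
Implicit Types (I : V -> Prop) (s : seq V) (f g h t x : V) (c : nat -> V).

(* This says that the initial ideal of I for the degree in y is the
   intersection of I' and of the ideal generated by the forms of I'' that are
   free of y. *)
Record glued I I' I'' : Prop := Glued {
  glued_hid : homogeneous_ideal I;
  glued_hid' : homogeneous_ideal I';
  glued_hid'' : homogeneous_ideal I'';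
  glued_y' : I' y;
  glued_y'' : I'' y;
  glued_lead : forall k c, (forall i, T (c i)) ->
    I (\sum_(i < k.+1) y ^+ i * c i) -> (if k is 0 then I' else I'') (c k);
  glued_low : forall f, T f -> I' f -> I f;
  glued_push : forall g, T g -> I'' g -> exists2 t, T t & I (y * g + t) }.

Section Fixed.
Variables (I I' I'' : V -> Prop).
Hypothesis gl : glued I I' I''.
Let hI := glued_hid gl.
Let hI' := glued_hid' gl.
Let hI'' := glued_hid'' gl.

Lemma glued_lead0 f : T f -> I f -> I' f.
Proof.
move=> fT If; apply: (glued_lead gl (k := 0) (c := fun=> f)) => //.
by rewrite big_ord_recl big_ord0 expr0 mul1r addr0.
Qed.

(** For g = [c m.+1], [glued_push] gives y g + t in [I]; its product with y^m cancels the top term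
    and alters only the coefficient of y^m. *)
Lemma glued_lower m c : (forall i, T (c i)) -> I'' (c m.+1) ->
  exists2 c' : nat -> V, forall i, T (c' i) &
    I (\sum_(i < m.+2) y ^+ i * c i - \sum_(i < m.+1) y ^+ i * c' i).
Proof.
move=> cT cI; have [t tT It] := glued_push gl (cT m.+1) cI.
exists (fun i => if i == m then c m - t else c i) => [i|].
  by case: ifP => _ //; apply: var_freeB.
rewrite big_ord_recr big_ord_recr [X in _ - X]big_ord_recr /= eqxx.
have -> : \sum_(i < m) y ^+ i * (if i == m :> nat then c m - t else c i) =
    \sum_(i < m) y ^+ i * c i.
  by apply: eq_bigr => i _; have := ltn_ord i; case: eqP => // ->; rewrite ltnn.
set S := \sum_(i < m) _.
have -> : S + y ^+ m * c m + y ^+ m.+1 * c m.+1 - (S + y ^+ m * (c m - t)) =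
  y ^+ m * (y * c m.+1 + t) by rewrite exprS; ring.
exact: hidM.
Qed.

Lemma sum_shift m c : y * \sum_(i < m.+1) y ^+ i * c i =
  \sum_(i < m.+2) y ^+ i * (if (i : nat) is i'.+1 then c i' else 0).
Proof.
rewrite [RHS]big_ord_recl /= mulr0 add0r mulr_sumr.
by apply: eq_bigr => i _; rewrite /bump /= exprS mulrA.
Qed.

(** Induction on the degree in [y]: as [x] is free of [y], the leading coefficient of x h is x times
    that of [h]. Regularity modulo [I''] puts the latter in [I''], so the top term can be removed;
    [I'] handles degree 0. *)
Lemma glued_reg x : T x -> reg I' x -> reg I'' x -> reg I x.
Proof.
move=> xT r' r'' h Ixh; have [m0 /(_ _ (leqnn _))[c cT hE]] := var_expansion j h.
move: m0 c cT h hE Ixh; elim=> [|m IH] c cT h hE Ixh.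
  move: hE Ixh; rewrite big_ord_recl big_ord0 expr0 mul1r addr0 => -> Ixc.
  apply: (glued_low gl) => //; apply: r'; apply: glued_lead0 => //.
  exact: var_freeM.
have cI : I'' (c m.+1).
  apply: r''; apply: (glued_lead gl (k := m.+1) (c := fun i => x * c i)) => [i|].
    exact: var_freeM.
  move: Ixh; rewrite hE mulr_sumr; congr I; apply: eq_bigr => i _; ring.
have [c' c'T Ic'] := glued_lower cT cI; rewrite -hE in Ic'.
set h' := \sum_(i < m.+1) _ in Ic'.
have Ih' : I h'.
  apply: (IH c' c'T h' erefl).
  have -> : x * h' = x * h - x * (h - h') by ring.
  by apply: hidB => //; apply: hidM.
by rewrite -[h](subrK h'); apply: hidD.
Qed.

(** The difficulty is the leading coefficient: in f = g + x h the degree of [h] in [y] may exceed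
    that of [f]. Then the top coefficient of [g] is -x times that of [h], so the latter lies in
    [I''] by regularity, and the excess can be lowered. *)
Lemma glued_addl x : x \is 1.-homog -> T x -> reg I'' x ->
  glued (addl I x) (addl I' x) (addl I'' x).
Proof.
move=> x1 xT r''; split; try exact: addl_hid.
- by apply: sub_addl; apply: glued_y' gl.
- by apply: sub_addl; apply: glued_y'' gl.
- move=> k c cT [g0 [h0 [Ig0 fE0]]].
  (* [m0] bounds by how much the degree of [h0] in [y] exceeds [k]; the induction is on this
     excess. *)
  have [m0 mP] := var_expansion j h0.
  have [d0 dT0 hE0] := mP (k + m0)%N (leq_addl _ _).
  move: g0 h0 d0 Ig0 fE0 dT0 hE0 {mP}; elim: m0 => [|r IH] g h d Ig fE dT hE.
    rewrite addn0 in hE.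
    have : (if k is 0 then I' else I'') (c k - x * d k).
      apply: (glued_lead gl (c := fun i => c i - x * d i)) => [i|].
        by apply: var_freeB => //; apply: var_freeM.
      under eq_bigr do rewrite mulrBr.
      rewrite sumrB fE hE mulr_sumr.
      rewrite (_ : \sum_(i < k.+1) y ^+ i * (x * d i) =
        \sum_(i < k.+1) x * (y ^+ i * d i)) ?addrK //.
      by apply: eq_bigr => i _; ring.
    case: k {fE hE} => [|k] Ik.
      by exists (c 0%N - x * d 0%N), (d 0%N); rewrite subrK.
    by exists (c k.+1 - x * d k.+1), (d k.+1); rewrite subrK.
  rewrite addnS in hE.
  have dI : I'' (d (k + r).+1).
    apply: r''; rewrite -[_ * _]opprK; apply: hidN => //.
    pose c1 i := (if (i < k.+1)%N then c i else 0) - x * d i.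
    have := glued_lead gl (k := (k + r).+1) (c := c1).
    rewrite {3}/c1 ltnNge ltnS leq_addr /= add0r; apply=> [i|].
      apply: var_freeB; last exact: var_freeM.
      by case: ifP => _ //; apply: var_free0.
    have -> : \sum_(i < (k + r).+2) y ^+ i * c1 i = g.
      rewrite -[RHS](addrK (x * h)) -fE hE mulr_sumr.
      have -> : \sum_(i < k.+1) y ^+ i * c i =
          \sum_(i < (k + r).+2) y ^+ i * (if (i < k.+1)%N then c i else 0).
        rewrite (big_ord_widen (k + r).+2 (fun i => y ^+ i * c i)); last first.
          by rewrite ltnS leqW ?leq_addr.
        rewrite big_mkcond; apply: eq_bigr => i _.
        by case: ifP => _; rewrite ?mulr0.
      rewrite -sumrB; apply: eq_bigr => i _; rewrite /c1; ring.
    exact: Ig.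
  have [d' d'T Id'] := glued_lower dT dI; rewrite -hE in Id'.
  set h' := \sum_(i < _) _ in Id'.
  apply: (IH (g + x * (h - h')) h' d') => //.
    by apply: hidD => //; apply: hidM.
  by rewrite fE; ring.
- move=> f fT [g [h [Ig fE]]]; rewrite -fT fE kill_varD kill_varM xT.
  exists (kill g), (kill h); split=> //; apply: (glued_low gl).
    exact: kill_var_free.
  by apply: kill_var_mem => //; apply: glued_y' gl.
- move=> f fT [g [h [Ig fE]]]; rewrite -fT fE kill_varD kill_varM xT.
  have [|t tT It] := glued_push gl (kill_var_free j g).
    by apply: kill_var_mem => //; apply: glued_y'' gl.
  exists t => //; exists (y * kill g + t), (y * kill h); split=> //; ring.
Qed.

End Fixed.

Lemma glued_adds I I' I'' s : glued I I' I'' -> linear_forms s ->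
  (forall t, t \in s -> T t) -> regs I' s -> regs I'' s ->
  regs I s /\ glued (adds I s) (adds I' s) (adds I'' s).
Proof.
elim: s I I' I'' => [|t s IH] I I' I'' //= gl /andP[t1 s1] sT [r' rs'] [r'' rs''].
have tT : T t by apply: sT; rewrite mem_head.
have [|rs gls] := IH _ _ _ (glued_addl gl t1 tT r'') s1 _ rs' rs''.
  by move=> u us; apply: sT; rewrite inE us orbT.
by split=> //; split=> //; apply: (glued_reg gl).
Qed.

(** The coloop case. If y h is in [I], the leading coefficient of [h] lies in [I''], hence in [I'],
    hence, being free of [y], in [I]; so the coefficients of [h] can be removed one by one. *)
Lemma glued_free_variable I I' I'' N : glued I I' I'' ->
  (forall f, I'' f -> I' f) -> spans I' N -> reg I y /\ spans (addl I y) N.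
Proof.
move=> gl sub sI'; have hI := glued_hid gl; split; last first.
  move=> f fN; have [f1 fE] := kill_var_decomp j f.
  exists (kill f), f1; split=> //; apply: (glued_low gl); first exact: kill_var_free.
  by apply: sI'; apply: homog_kill_var.
move=> h Iyh; have [m0 /(_ _ (leqnn _))[c cT hE]] := var_expansion j h.
have Ic (m : nat) c0 : (forall i, T (c0 i)) ->
    I (y * \sum_(i < m.+1) y ^+ i * c0 i) -> I (c0 m).
  move=> c0T; rewrite sum_shift => Is; apply: (glued_low gl) => //; apply: sub.
  apply: (glued_lead gl (k := m.+1)
    (c := fun i => if i is i'.+1 then c0 i' else 0)) Is.
  by case=> //; apply: var_free0.
rewrite hE in Iyh *; elim: m0 Iyh {hE} => [|m IH] Is.
  have := Ic _ _ cT Is.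
  by rewrite big_ord_recl big_ord0 expr0 mul1r addr0.
have Icm := Ic _ _ cT Is; rewrite big_ord_recr /= in Is *.
apply: hidD => //; last exact: hidM.
apply: IH; rewrite -[y * _](addrK (y * (y ^+ m.+1 * c m.+1))) -mulrDr.
by apply: hidB => //; apply: hidM => //; apply: hidM.
Qed.

Lemma spans_subst I x N : homogeneous_ideal I -> x \is 1.-homog -> T x ->
  (forall f, T f -> f \is N.-homog -> I f) -> I (y - x) -> spans I N.
Proof.
move=> hI x1 xT TI Iyx f fN.
have [g [h [gT gN ->]]] := linear_subst x1 xT fN.
by apply: hidD => //; [apply: TI | apply: hidMr].
Qed.

End Gluing.

(** Apart from [H], the dimension does not depend on [m]: two maps for which [G] has the same
    preimage [H] in [U] give sums of equal dimension. *)
Lemma dim_add_img (K : fieldType) (A B : vectType K) (m : 'Hom(A, B))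
    (G : {vspace B}) (U H : {vspace A}) :
  (forall v, (v \in H) = (v \in U) && (m v \in G)) ->
  (\dim (G + m @: U) + \dim H = \dim G + \dim U)%N.
Proof.
move=> HP.
have e1 := limg_ker_dim m U; have e2 := limg_ker_dim m H.
have e3 := dimv_sum_cap G (m @: U)%VS.
have k : (H :&: lker m = U :&: lker m)%VS.
  apply/vspaceP => v; rewrite !memv_cap HP memv_ker.
  by case: eqP => [->|_]; rewrite ?mem0v ?andbT ?andbF.
have i : (G :&: m @: U = m @: H)%VS.
  apply/vspaceP => w; rewrite memv_cap; apply/andP/memv_imgP.
    by move=> [wG /memv_imgP[v vU wE]]; exists v; rewrite // HP vU -wE.
  by move=> [v]; rewrite HP => /andP[vU vG] ->; rewrite memv_img.
by rewrite k in e2; rewrite i in e3; lia.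
Qed.

(** * The last form of the sequence, perturbed by the variable *)

Section LastForm.
Variables (K : numClosedFieldType) (n : nat) (j : 'I_n.+1).
Local Notation V := {mpoly K[n.+1]}.
Local Notation pi := (pihomog mdeg).
Local Notation y := ('X_j : V).
Local Notation T := (var_free j).
Local Notation kill := (kill_var j).
Local Notation piece q := (dhomog n.+1 K q).

Variables (I I' I'' : V -> Prop) (x : V) (r : nat).
Hypotheses (gl : glued j I I' I'') (x1 : x \is 1.-homog) (xT : T x).
Hypotheses (rx : reg I' x) (sx : spans (addl I' x) r.+1) (s'' : spans I'' r).
Let hI := glued_hid gl.
Let hI' := glued_hid' gl.
Let hI'' := glued_hid'' gl.
Let y1 : y \is 1.-homog := homog_var K j.

Let T_piece q : exists U : {vspace piece q}, forall u, u \in U <-> T (val u).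
Proof.
apply: exists_vspace; first exact: var_free0.
by move=> c u v uT vT; rewrite linearP; apply: var_freeD => //; apply: var_freeZ.
Qed.

Let good q t := forall f, f \is q.-homog -> T f -> I ((x + t *: y) * f) -> I' f.

Let mulz_low t f : T f -> I' f -> I ((x + t *: y) * f).
Proof. by move=> fT I'f; apply: hidM => //; apply: (glued_low gl). Qed.

Let z1 t : x + t *: y \is 1.-homog.
Proof. by rewrite dhomogD ?dhomogZ. Qed.

(** On forms free of [y] the ideals [I] and [I'] agree, so [x] is injective modulo [I] on a
    complement [D] of [I'], and [pencil_inj] applies. The bad set depends on [q], so only finitely
    many degrees can be treated this way. *)
Let good_small q : exists bad : seq K, forall t, t \notin bad -> good q t.
Proof.
have [U UP] := T_piece q.
pose D := (U :\: hpiece I' q)%VS.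
have [|bad badP] := @pencil_inj K _ _ (mulp x q) (mulp y q) D (hpiece I q.+1).
  move=> f fD /(hpieceP _ hI); rewrite mulpE // => Ixf.
  have /UP fT : f \in U by apply: subvP fD; apply: diffvSl.
  have : f \in (D :&: hpiece I' q)%VS.
    rewrite memv_cap fD; apply/(hpieceP _ hI'); apply: rx.
    by apply: (glued_lead0 gl) => //; apply: var_freeM.
  by rewrite capv_diff memv0 => /eqP.
exists bad => t /badP tP f fq fT Izf.
have /memv_addP[d dD [g /(hpieceP _ hI') I'g fE]] : to_piece q f \in (D + hpiece I' q)%VS.
  by rewrite addv_diff (subvP (addvSl _ _)) //; apply/UP; rewrite to_pieceK.
have dT : T (val d) by apply/UP; apply: subvP dD; apply: diffvSl.
have {}fE : f = val d + val g by rewrite -[f](to_pieceK fq) fE.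
have gT : T (val g).
  have -> : val g = f - val d by rewrite fE addrC addKr.
  exact: var_freeB.
have d0 : d = 0.
  apply: tP => //; apply/(hpieceP _ hI).
  have -> : val (mulp x q d + t *: mulp y q d) = (x + t *: y) * f - (x + t *: y) * val g.
    rewrite -mulrBr fE addrK mulrDl -scalerAl.
    by rewrite -!mulpE.
  by apply: hidB => //; apply: mulz_low.
by rewrite fE d0 add0r.
Qed.

(* On elements involving y, multiplication by x + t y is detected by leading
   coefficients modulo I'', for every t <> 0.  On elements free of y, x itself
   is injective modulo I, hence so is x + t y up to degree r for generic t, and
   in higher degrees because I'' contains everything there. *)
Lemma glued_last : exists2 t : K, t != 0 &
  reg I (x + t *: y) /\ spans (addl I (x + t *: y)) r.+1.
Proof.
have [bad badP] := boolp.choice good_small.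
have [t] := exists_notin (0 :: flatten [seq bad q | q <- iota 0 r.+1]).
rewrite inE negb_or => /andP[t0 tbad].
pose z := x + t *: y; have z1' : z \is 1.-homog := z1 t.
have gsmall q : (q <= r)%N -> good q t.
  move=> qr; apply: badP; apply: contra tbad => tb.
  by apply/flattenP; exists (bad q) => //; apply: map_f; rewrite mem_iota.
(* From degree r on [I''] contains everything, so y f, and hence z f, can be made free of [y] modulo
   [I]. *)
have push q f : (r <= q)%N -> f \is q.-homog -> T f -> exists2 w, T w & I (z * f - w).
  move=> rq fq fT.
  have I''f : I'' f by apply: (spans_le hI'' rq s'').
  have [s sT Is] := glued_push gl fT I''f.
  exists (x * f - t *: s); first by apply: var_freeB; [apply: var_freeM|apply: var_freeZ].
  have -> : z * f - (x * f - t *: s) = t *: (y * f + s).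
    by rewrite /z scalerDr mulrDl -scalerAl; ring.
  exact: hidZ.
(* Above degree r write f = g + x h with g in [I'] and let [w] represent z h. Then x w is in [I], so
   [w] is, and the previous degree applies to [h]. *)
have allgood q : good q t.
  have [/gsmall //|] := leqP q r; elim: q => // q IH; rewrite ltnS => rq f fq fT Izf.
  have IHq : good q t by move: rq; rewrite leq_eqVlt => /predU1P[<-|]; [apply: gsmall|].
  have [g [h [I'g hq fE]]] : exists g h, [/\ I' g, h \is q.-homog & f = g + x * h].
    by apply: addl_homog => //; apply: (spans_le _ _ sx fq) => //; apply: addl_hid.
  have kfE : f = kill g + x * kill h by rewrite -fT fE kill_varD kill_varM xT.
  have I'kg : I' (kill g) by apply: kill_var_mem => //; apply: glued_y' gl.
  have khq := homog_kill_var j hq; have khT := kill_var_free j h.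
  have [w wT Iw] := push q _ rq khq khT.
  have Ixw : I (x * w).
    have -> : x * w = z * f - z * kill g - x * (z * kill h - w) by rewrite {1}kfE; ring.
    apply: hidB => //; last exact: hidM.
    by apply: hidB => //; apply: mulz_low => //; apply: kill_var_free.
  have Iw' : I w.
    apply: (glued_low gl) => //; apply: rx; apply: (glued_lead0 gl) => //.
    exact: var_freeM.
  rewrite kfE; apply: hidD => //; apply: hidM => //; apply: (IHq _ khq) => //.
  by rewrite -/z -[z * _](subrK w); apply: hidD.
exists t => //; rewrite -/z; split.
  apply: reg_homog => // q f fq Izf.
  (* If [f] involves [y], the leading coefficient of z f is t times that of [f]. As [t] is nonzero,
     the latter lies in [I''] and the degree in [y] can be lowered. *)
  have [f' f'T If'] : exists2 f', T f' & I (f - f').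
    have [m0 /(_ _ (leqnn _))[c cT fE]] := var_expansion j f.
    rewrite fE in Izf *; elim: m0 c cT Izf {fE} => [|m IH] c cT Izf.
      exists (c 0%N) => //; rewrite big_ord_recl big_ord0 expr0 mul1r addr0 subrr.
      exact: hid0.
    have cI : I'' (c m.+1).
      have := glued_lead gl (k := m.+2) (c := fun i => 
        (if (i < m.+2)%N then x * c i else 0) + t *: (if i is i'.+1 then c i' else 0)).
      rewrite /= ltnn add0r => H; rewrite -[c _]scale1r -(mulVf t0) -scalerA.
      apply: hidZ => //; apply: H => [i|].
        apply: var_freeD; first by case: ifP => _; [apply: var_freeM|apply: var_free0].
        by apply: var_freeZ; case: i => //; apply: var_free0.
      move: Izf; rewrite mulrDl -scalerAl sum_shift; congr I.
      under [RHS]eq_bigr do rewrite mulrDr.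
      rewrite [RHS]big_split /=; congr (_ + _).
        rewrite [RHS]big_ord_recr /= ltnn mulr0 addr0 mulr_sumr.
        by apply: eq_bigr => i _; rewrite ltn_ord; ring.
      by rewrite scaler_sumr; apply: eq_bigr => i _; rewrite scalerAr.
    have [c' c'T Ic'] := glued_lower gl cT cI.
    have [|f' f'T If'] := IH c' c'T.
      set h' := \sum_(i < m.+1) _ in Ic' *; set h := \sum_(i < _) _ in Izf Ic'.
      have -> : (x + t *: y) * h' = (x + t *: y) * h - (x + t *: y) * (h - h') by ring.
      by apply: hidB => //; apply: hidM.
    exists f' => //; rewrite -[_ - f'](subrKA (\sum_(i < m.+1) y ^+ i * c' i)).
    exact: hidD.
  have fqE := pihomog_dE fq.
  have If'' : I (f - pi q f').
    by rewrite -fqE -raddfB; apply: hidH.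
  rewrite -[f](subrK (pi q f')); apply: hidD => //.
  have f''T := var_free_pihomog q f'T.
  apply: (glued_low gl) => //; apply: (allgood q) => //; first exact: pihomogP.
  have -> : (x + t *: y) * pi q f' = z * f - z * (f - pi q f') by rewrite /z; ring.
  by apply: hidB => //; apply: hidM.
have hIz := addl_hid hI z1'.
(* Modulo z = x + t y the variable [y] equals -x/t, so only forms free of [y] have to be reached. *)
apply: (spans_subst (j := j) (x := - t^-1 *: x) hIz) => //.
- by rewrite dhomogZ.
- exact: var_freeZ.
- have [U UP] := T_piece r; have [W WP] := T_piece r.+1.
  pose G := hpiece I r.+1; pose H := (U :&: hpiece I' r)%VS.
  (* Multiplication by [x] and by [z] on [U] has the same kernel [H] modulo [G], so G + x U and G +
     z U have equal dimension. The first contains G + W and the second lies in it, so both equal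
     it. *)
  have HP m : m = x \/ m = z -> forall v, (v \in H) = (v \in U) && (mulp m r v \in G).
    move=> mxz v; rewrite memv_cap; have m1 : m \is 1.-homog by case: mxz => ->.
    apply/andP/andP => -[vU vI]; have /UP vT := vU; split=> //.
      apply/(hpieceP _ hI); rewrite mulpE //; apply: hidM => //.
      by apply: (glued_low gl) => //; apply/(hpieceP _ hI').
    move/(hpieceP _ hI): vI; rewrite mulpE // => vI; apply/(hpieceP _ hI').
    case: mxz vI => -> vI; last exact: (allgood r _ (valP v)).
    by apply: rx; apply: (glued_lead0 gl) => //; apply: var_freeM.
  have ex := dim_add_img (HP x (or_introl erefl)).
  have ez := dim_add_img (HP z (or_intror erefl)).
  have xW : (W <= G + mulp x r @: U)%VS.
    apply/subvP => w /WP wT.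
    have [g [h [I'g hq fE]]] : exists g h, [/\ I' g, h \is r.-homog & val w = g + x * h].
      by apply: addl_homog => //; [apply: valP | apply: sx; apply: valP].
    have kfE : val w = kill g + x * kill h by rewrite -wT fE kill_varD kill_varM xT.
    have khr := homog_kill_var j hq.
    have -> : w = (w - mulp x r (to_piece r (kill h))) + mulp x r (to_piece r (kill h)).
      by rewrite subrK.
    apply: memv_add; last first.
      by apply: memv_img; apply/UP; rewrite to_pieceK //; apply: kill_var_free.
    apply/(hpieceP _ hI).
    have -> : val (w - mulp x r (to_piece r (kill h))) = kill g.
      by rewrite raddfB /= mulpE // to_pieceK // kfE addrK.
    apply: (glued_low gl); first exact: kill_var_free.
    by apply: kill_var_mem => //; apply: glued_y' gl.
  have zW : (G + mulp z r @: U <= G + W)%VS.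
    rewrite subv_add addvSl; apply/subvP => _ /memv_imgP[u /UP uT ->].
    have [w wT Iw] := push r _ (leqnn r) (valP u) uT.
    have wq : pi r.+1 w \is r.+1.-homog by apply: pihomogP.
    rewrite -[mulp z r u](subrK (to_piece r.+1 w)); apply: memv_add; last first.
      by apply/WP; apply: var_free_pihomog.
    apply/(hpieceP _ hI).
    have -> : val (mulp z r u - to_piece r.+1 w) = pi r.+1 (z * val u - w).
      by rewrite !raddfB /= mulpE // (pihomog_dE (linear_homogM _ (valP u))).
    exact: hidH.
  have GWx : (G + W <= G + mulp x r @: U)%VS by rewrite subv_add addvSl xW.
  have /eqP eGz : (G + mulp z r @: U)%VS == (G + W)%VS.
    rewrite eqEdim zW /= (leq_trans (dimvS GWx)) //.
    by rewrite -(leq_add2r (\dim H)) ex -ez.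
  move=> f fT fr.
  have : to_piece r.+1 f \in (G + mulp z r @: U)%VS.
    rewrite eGz (subvP (addvSr _ _)) //; apply/WP; rewrite to_pieceK //.
  case/memv_addP => g /(hpieceP _ hI) Ig [_ /memv_imgP[u _ ->] fE].
  exists (val g), (val u); split=> //.
  by rewrite -(mulpE _ z1') -[LHS](to_pieceK fr) fE.
- exists 0, (t^-1)%:MP; split; first exact: hid0.
  rewrite /z add0r scaleNr opprK mulrDl -!mul_mpolyC.
  rewrite mulrC addrC mulrAC -mpolyCM divff // mul1r; ring.
Qed.

End LastForm.

(** * Arrangements, deletion and contraction *)

Lemma poly_cofinite0 (K : numClosedFieldType) (p : {poly K}) (bad : seq K) :
  (forall t, t \notin bad -> p.[t] = 0) -> p = 0.
Proof.
move=> p0; apply: contrapT => /eqP pn0; have [s sP] := closed_field_roots pn0.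
have [t] := exists_notin (bad ++ s); rewrite mem_cat negb_or => /andP[tb ts].
by move/negP: ts; apply; apply: sP; rewrite /root p0.
Qed.

Lemma var_free_meval (K : numClosedFieldType) (n : nat) (j : 'I_n.+1)
    (f : {mpoly K[n.+1]}) (u u' : 'I_n.+1 -> K) :
  var_free j f -> (forall i, i != j -> u i = u' i) -> f.@[u] = f.@[u'].
Proof.
move=> <- uu'; rewrite /kill_var !comp_mpoly_meval; apply: meval_eq => i.
rewrite tnth_mktuple; case: eqP => [_|/eqP ij]; first by rewrite !meval0.
by rewrite !mevalXU uu'.
Qed.

(** * Limits of reciprocals along a line *)

Section Lines.
Variables (K : numClosedFieldType) (n : nat).
Local Notation V := {mpoly K[n.+1]}.
Variables w v : 'rV[K]_n.+1.
Let a i (t : K) := w 0 i + t * v 0 i.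

Lemma line_avoids : exists bad : seq K, forall t, t \notin bad ->
  forall i, (w 0 i != 0) || (v 0 i != 0) -> (w + t *: v) 0 i != 0.
Proof.
exists [seq - w 0 i / v 0 i | i : 'I_n.+1] => t tb i; rewrite !mxE => wv.
have [v0|v0] := eqVneq (v 0 i) 0; first by move: wv; rewrite v0 mulr0 addr0 eqxx orbF.
apply: contra tb; rewrite addrC addr_eq0 => /eqP tv.
by apply/imageP; exists i => //; rewrite -tv mulfK.
Qed.

Let good (t : K) := forall i, w 0 i != 0 -> a i t != 0.
Let Q (t : K) := \prod_(i | w 0 i != 0) a i t.

(* Functions of t whose product with a power of Q is a polynomial wherever Q
   does not vanish. *)
Let ratl (phi : K -> K) := exists (P : {poly K}) (M : nat),
  forall t, good t -> P.[t] = phi t * Q t ^+ M.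

Let pa i : {poly K} := (w 0 i)%:P + (v 0 i) *: 'X.

Let paE i t : (pa i).[t] = a i t.
Proof. by rewrite /pa !hornerE mulrC. Qed.

Let ratl_poly (p : {poly K}) : ratl (fun t => p.[t]).
Proof. by exists p, 0%N => t _; rewrite expr0 mulr1. Qed.

Let QE t : (\prod_(i | w 0 i != 0) pa i).[t] = Q t.
Proof. by rewrite horner_prod; apply: eq_bigr => i _; rewrite paE. Qed.

Let ratlD phi psi : ratl phi -> ratl psi -> ratl (fun t => phi t + psi t).
Proof.
move=> [P [M PM]] [P' [M' PM']]; set q := \prod_(i | w 0 i != 0) pa i.
exists (P * q ^+ M' + P' * q ^+ M), (M + M')%N => t gt.
by rewrite !hornerE !QE PM // PM' // exprD; ring.
Qed.

Let ratlM phi psi : ratl phi -> ratl psi -> ratl (fun t => phi t * psi t).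
Proof.
move=> [P [M PM]] [P' [M' PM']]; exists (P * P'), (M + M')%N => t gt.
by rewrite hornerM PM // PM' // exprD; ring.
Qed.

Let ratl_sum k (F : 'I_k -> K -> K) :
  (forall i, ratl (F i)) -> ratl (fun t => \sum_i F i t).
Proof.
move=> FP; elim: (index_enum _) => [|i r IHr].
  by have := ratl_poly 0; congr ratl; apply: funext => t; rewrite big_nil hornerC.
have -> : (fun t => \sum_(i <- i :: r) F i t) =
  (fun t => F i t + \sum_(i <- r) F i t).
  by apply: funext => t; rewrite big_cons.
exact: ratlD.
Qed.

(** Entries where [w] vanishes are set to 0, which keeps everything regular at t = 0. This is the
    true inverse if [v] vanishes there too; otherwise the inverse has a pole at t = 0. *)
Let b (t : K) i := if w 0 i != 0 then (a i t)^-1 else 0.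

Let ratl_b i : ratl (b^~ i).
Proof.
rewrite /b; have [w0|w0] := boolP (w 0 i != 0); last first.
  by exists 0, 0%N => t _; rewrite hornerC mul0r.
exists (\prod_(k | (w 0 k != 0) && (k != i)) pa k), 1%N => t gt.
rewrite expr1 /Q [X in _ = _ * X](bigD1 i) //= mulrA mulVf ?gt // mul1r horner_prod.
by apply: eq_bigr => k _; rewrite paE.
Qed.

Let ratl_meval (f : V) : ratl (fun t => f.@[b t]).
Proof.
elim/mpolyind: f => [|c m p _ _ IH].
  by exists 0, 0%N => t _; rewrite hornerC meval0 mul0r.
have -> : (fun t => (c *: 'X_[m] + p).@[b t]) =
    (fun t => c * \prod_i b t i ^+ m i + p.@[b t]).
  by apply: funext => t; rewrite mevalD mevalZ mevalX.
apply: ratlD => //; apply: ratlM.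
  by have := ratl_poly c%:P; congr ratl; apply: funext => t; rewrite hornerC.
elim: (index_enum _) => [|i r IHr].
  have := ratl_poly 1; congr ratl; apply: funext => t.
  by rewrite big_nil hornerC.
have -> : (fun t => \prod_(i <- i :: r) b t i ^+ m i) =
  (fun t => b t i ^+ m i * \prod_(i <- r) b t i ^+ m i).
  by apply: funext => t; rewrite big_cons.
apply: ratlM => //; elim: (m i) => [|k IHk].
  by have := ratl_poly 1; congr ratl; apply: funext => t; rewrite hornerC.
have -> : (fun t => b t i ^+ k.+1) = (fun t => b t i * b t i ^+ k).
  by apply: funext => t; rewrite exprS.
by apply: ratlM.
Qed.

(** After clearing denominators a polynomial with almost all values 0 remains, hence 0; and [Q 0] is
    a product of nonzero coordinates of [w]. *)
Let ratl_zero phi (bad : seq K) : ratl phi ->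
  (forall t, t \notin bad -> good t -> phi t = 0) -> phi 0 = 0.
Proof.
move=> [P [M PM]] phi0; have [bad' bad'P] := line_avoids.
have P0 : P = 0.
  apply: (@poly_cofinite0 _ _ (bad ++ bad')) => t.
  rewrite mem_cat negb_or => /andP[tb tb'].
  have gt : good t by move=> i w0; have := bad'P t tb' i; rewrite w0 !mxE; apply.
  by rewrite PM // phi0 // mul0r.
have gd0 : good 0 by move=> i; rewrite /a mul0r addr0.
have := PM 0 gd0; rewrite P0 horner0 => /esym/eqP; rewrite mulf_eq0 expf_eq0.
have Q0 : Q 0 != 0 by apply/prodf_neq0 => i; apply: gd0.
by rewrite (negPf Q0) andbF orbF => /eqP.
Qed.

Let meval_b j t (f : V) : var_free j f ->
  (forall i, i != j -> w 0 i = 0 -> v 0 i = 0) ->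
  f.@[fun l => ((w + t *: v) 0 l)^-1] = f.@[b t].
Proof.
move=> fT wv; apply: (var_free_meval fT) => l lj; rewrite /b !mxE.
by case: eqP => //= w0; rewrite w0 wv // mulr0 addr0 invr0.
Qed.

(** Only coordinate [j] may have a pole at t = 0. The powers with exponent k - i arise from the sum
    of the y^i c_i, where y is the inverse of coordinate [j], by multiplying with the k-th power of
    that coordinate, which removes the pole. *)
Lemma line_limit (j : 'I_n.+1) k (c : nat -> V) (bad : seq K) :
  (forall i, var_free j (c i)) ->
  (forall i, i != j -> w 0 i = 0 -> v 0 i = 0) ->
  (forall t, t \notin bad -> \sum_(i < k.+1) (w + t *: v) 0 j ^+ (k - i) *
     (c i).@[fun l => ((w + t *: v) 0 l)^-1] = 0) ->
  \sum_(i < k.+1) w 0 j ^+ (k - i) * (c i).@[fun l => (w 0 l)^-1] = 0.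
Proof.
move=> cT wv0 H.
have e : \sum_(i < k.+1) a j 0 ^+ (k - i) * (c i).@[b 0] = 0.
  apply: (@ratl_zero (fun t => \sum_(i < k.+1) a j t ^+ (k - i) * (c i).@[b t]) bad).
    apply: ratl_sum => i; apply: ratlM => //.
    have := ratl_poly (pa j ^+ (k - i)); congr ratl; apply: funext => t.
    by rewrite horner_exp paE.
  move=> t tb _; apply: etrans (H t tb); apply: eq_bigr => i _.
  by rewrite (meval_b _ (cT i)) // !mxE.
apply: etrans e; apply: eq_bigr => i _.
by rewrite -(meval_b 0 (cT i)) // scale0r addr0 /a mul0r addr0.
Qed.

Lemma line_limit_meval (f : V) (bad : seq K) : (forall i, w 0 i != 0) ->
  (forall t, t \notin bad -> f.@[fun l => ((w + t *: v) 0 l)^-1] = 0) ->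
  f.@[fun l => (w 0 l)^-1] = 0.
Proof.
move=> w0 H; have bE t : f.@[b t] = f.@[fun l => ((w + t *: v) 0 l)^-1].
  by apply: meval_eq => i; rewrite /b w0 !mxE.
have e : f.@[b 0] = 0.
  by apply: (@ratl_zero (fun t => f.@[b t]) bad) => // t tb _; rewrite bE H.
by rewrite -e bE scale0r addr0.
Qed.

End Lines.

Section IdealGen.
Variables (A : comNzRingType) (G : A -> Prop).

Lemma ideal_gen0 : ideal_gen G 0.
Proof. by exists [::]; rewrite ?big_nil. Qed.

Lemma ideal_genD f g : ideal_gen G f -> ideal_gen G g -> ideal_gen G (f + g).
Proof.
move=> [s sG ->] [s' sG' ->]; exists (s ++ s'); last by rewrite big_cat.
by move=> u; rewrite mem_cat => /orP[/sG|/sG'].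
Qed.

Lemma ideal_genM f g : ideal_gen G g -> ideal_gen G (f * g).
Proof.
move=> [s sG ->]; exists [seq (f * u.1, u.2) | u <- s].
  by move=> _ /mapP[u us ->]; apply: sG us.
by rewrite big_map mulr_sumr; apply: eq_bigr => u _; rewrite mulrA.
Qed.

Lemma ideal_gen_mem g : G g -> ideal_gen G g.
Proof.
move=> Gg; exists [:: (1, g)]; last by rewrite big_seq1 mul1r.
by move=> u; rewrite inE => /eqP ->.
Qed.

Lemma ideal_gen_ind (P : A -> Prop) :
  P 0 -> (forall f g, P f -> P g -> P (f + g)) ->
  (forall f g, G g -> P (f * g)) -> forall f, ideal_gen G f -> P f.
Proof.
move=> P0 PD PM f [s sG ->]; rewrite big_seq.
by elim/big_ind: _ => // u us; apply: PM; apply: sG.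
Qed.

End IdealGen.

Section Arrangement.
Variables (K : numClosedFieldType) (n : nat).
Local Notation V := {mpoly K[n.+1]}.
Local Notation pi := (pihomog mdeg).
Local Notation E := 'rV[K]_n.+1.
Implicit Types (W : {vspace E}) (w v : E) (f g : V) (j : 'I_n.+1).

Definition loop W i := `[< forall w, w \in W -> w 0 i = 0 >].
Definition generic W w := w \in W /\ forall i, ~~ loop W i -> w 0 i != 0.

(* With 0^-1 = 0, the variable of a loop vanishes on every reciprocal point. *)
Definition recip w : 'I_n.+1 -> K := fun i => (w 0 i)^-1.
Definition arr_ideal W f := forall w, generic W w -> f.@[recip w] = 0.

Lemma loopP W i : reflect (forall w, w \in W -> w 0 i = 0) (loop W i).
Proof. exact: asboolP. Qed.

Lemma nloopP W i : ~~ loop W i -> exists2 w, w \in W & w 0 i != 0.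
Proof.
move/loopP => nl; apply: contrapT => nw; apply: nl => w wW; apply/eqP.
by apply: contrapT => /negP w0; apply: nw; exists w.
Qed.

Lemma generic_exists W : exists w, generic W w.
Proof.
suff [w [wW wP]] : exists w, w \in W /\
    forall i, i \in index_enum 'I_n.+1 -> ~~ loop W i -> w 0 i != 0.
  by exists w; split=> // i; apply: wP; rewrite mem_index_enum.
elim: (index_enum _) => [|i s [w [wW wP]]]; first by exists 0; rewrite mem0v.
have [li|/nloopP[v vW vi]] := boolP (loop W i).
  exists w; split=> // k; rewrite inE => /predU1P[-> /negP //|]; exact: wP.
have [bad badP] := line_avoids w v; have [t tb] := exists_notin bad.
exists (w + t *: v); split; first by rewrite memvD ?memvZ.
move=> k; rewrite inE => /predU1P[-> _|ks kl]; apply: badP => //.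
  by rewrite vi orbT.
by rewrite wP.
Qed.

Lemma generic_scale W w (c : K) : c != 0 -> generic W w -> generic W (c *: w).
Proof.
move=> c0 [wW wP]; split=> [|i /wP]; first by rewrite memvZ.
by rewrite mxE mulf_eq0 (negPf c0).
Qed.

(** Generic vectors are stable under nonzero scalars. Along the multiples of one reciprocal point,
    [f] is a polynomial in the scalar whose coefficients are the values of its homogeneous
    components; it vanishes off 0, so each component does. *)
Lemma arr_ideal_hid W : homogeneous_ideal (arr_ideal W).
Proof.
split=> [w _|f g If Ig w gw|f g Ig w gw|d f If w gw].
- exact: meval0.
- by rewrite mevalD If // Ig // addr0.
- by rewrite mevalM Ig // mulr0.
have [k fE] := pihomog_sum f.
pose p : {poly K} := \poly_(d < k) (pi d f).@[recip w].
have p0 : p = 0.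
  apply: (@poly_cofinite0 _ _ [:: 0]) => c; rewrite inE => c0.
  have /If e : generic W (c^-1 *: w) by apply: generic_scale; rewrite ?invr_eq0.
  rewrite horner_poly; apply: etrans e; rewrite [in RHS]fE raddf_sum /=.
  apply: eq_bigr => i _.
  rewrite mulrC -(meval_homogZ _ _ (pihomogP mdeg i f)); apply: meval_eq => l.
  by rewrite /recip mxE invfM invrK.
have [dk|kd] := ltnP d k.
  by have := coef_poly k (fun d => (pi d f).@[recip w]) d; rewrite -/p p0 coef0 dk.
rewrite (_ : pi d f = 0) ?meval0 // fE raddf_sum /= big1 // => i _.
by rewrite (@pihomog_ne0 _ _ _ i) ?pihomogP //; have := ltn_ord i; lia.
Qed.

(** The vector [w] may have coordinate [j] equal to 0. It is approached by generic vectors w + t v,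
    for which the sum is a power of coordinate [j] times the value of the given polynomial. *)
Lemma arr_ideal_lead W j k (c : nat -> V) w : ~~ loop W j ->
  (forall i, var_free j (c i)) ->
  w \in W -> (forall i, i != j -> ~~ loop W i -> w 0 i != 0) ->
  arr_ideal W (\sum_(i < k.+1) 'X_j ^+ i * c i) ->
  \sum_(i < k.+1) w 0 j ^+ (k - i) * (c i).@[recip w] = 0.
Proof.
move=> lj cT wW wP If; have [v [vW vP]] := generic_exists W.
have [bad badP] := line_avoids w v.
apply: (line_limit (v := v) (bad := bad) cT) => [i ij w0|t tb].
  have [/loopP ->//|/(wP i ij)] := boolP (loop W i); by rewrite w0 eqxx.
set u := w + t *: v; have gu : generic W u.
  split=> [|i li]; first by rewrite memvD ?memvZ.
  by apply: badP; rewrite ?vP ?orbT.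
have u0 : u 0 j != 0 by apply: gu.2.
have := If u gu; rewrite raddf_sum /= => /(congr1 ( *%R (u 0 j ^+ k))).
rewrite mulr0 mulr_sumr => e; apply: etrans e; apply: eq_bigr => i _.
rewrite mevalM rmorphXn /= mevalXU {2}/recip mulrA; congr (_ * _).
have ik : (i <= k)%N by rewrite -ltnS.
apply: (mulIf (expf_neq0 i u0)).
by rewrite -exprD subnK // -mulrA -exprMn mulVf // expr1n mulr1.
Qed.

Definition zero_coord j w : E := \row_i (if i == j then 0 else w 0 i).
Definition keep_coord j w : E := \row_i (if i == j then w 0 i else 0).

Fact zero_coord_linear j : linear (zero_coord j).
Proof.
move=> c u v; apply/rowP => i; rewrite !mxE; case: eqP => _ //.
by rewrite mulr0 addr0.
Qed.
HB.instance Definition _ j :=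
  GRing.isLinear.Build K E E *:%R (zero_coord j) (zero_coord_linear j).

Fact keep_coord_linear j : linear (keep_coord j).
Proof.
move=> c u v; apply/rowP => i; rewrite !mxE; case: eqP => _ //.
by rewrite mulr0 addr0.
Qed.
HB.instance Definition _ j :=
  GRing.isLinear.Build K E E *:%R (keep_coord j) (keep_coord_linear j).

(** Deletion and contraction keep all coordinates and turn [j] into a loop instead of dropping it,
    so that one polynomial ring serves throughout the induction. *)
Definition deletion j W := (linfun (zero_coord j) @: W)%VS.
Definition contraction j W := (W :&: lker (linfun (keep_coord j)))%VS.

Lemma deletionP j W v : reflect (exists2 w, w \in W & v = zero_coord j w) (v \in deletion j W).
Proof.
by apply: (iffP memv_imgP) => -[w wW ->]; exists w => //; rewrite lfunE.
Qed.

Lemma contractionP j W w : (w \in contraction j W) = (w \in W) && (w 0 j == 0).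
Proof.
rewrite memv_cap memv_ker lfunE /=; congr (_ && _); apply/eqP/eqP => [/rowP/(_ j)|w0].
  by rewrite !mxE eqxx.
by apply/rowP => i; rewrite !mxE; case: eqP => // ->.
Qed.

Lemma loop_deletion j W i : loop (deletion j W) i = (i == j) || loop W i.
Proof.
apply/loopP/orP => [H|[/eqP ->|/loopP H] v /deletionP[w wW ->]].
- have [->|ij] := eqVneq i j; [by left | right; apply/loopP => w wW].
  have := H (zero_coord j w); rewrite mxE (negPf ij); apply.
  by apply/deletionP; exists w.
- by rewrite mxE eqxx.
- by rewrite mxE H //; case: ifP.
Qed.

Lemma loop_contraction j W i : (i == j) || loop W i -> loop (contraction j W) i.
Proof.
case/orP => [/eqP ->|/loopP li]; apply/loopP => w; rewrite contractionP => /andP[wW /eqP w0] //.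
exact: li.
Qed.

Lemma dim_contraction j W : ~~ loop W j -> (\dim (contraction j W)).+1 = \dim W.
Proof.
case/nloopP => v vW vj; rewrite -(limg_ker_dim (linfun (keep_coord j)) W) -addn1.
congr (_ + _)%N; apply/esym.
have -> : (linfun (keep_coord j) @: W = <[keep_coord j v]>)%VS.
  apply/vspaceP => u; apply/memv_imgP/vlineP => [[w wW ->]|[c ->]].
    exists (w 0 j / v 0 j); rewrite lfunE; apply/rowP => i; rewrite !mxE.
    by case: eqP => [->|]; rewrite ?mulr0 // divfK.
  by exists (c *: v); rewrite ?memvZ // linearZ /= lfunE.
rewrite dim_vline; suff -> : keep_coord j v != 0 by [].
by apply: contraNneq vj => /rowP/(_ j); rewrite !mxE eqxx => ->.
Qed.

Lemma zero_coord0 j w : w 0 j = 0 -> zero_coord j w = w.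
Proof. by move=> w0; apply/rowP => i; rewrite mxE; case: eqP => // ->. Qed.

Lemma zero_coordE j w : zero_coord j w = w - w 0 j *: delta_mx 0 j.
Proof.
apply/rowP => i; rewrite !mxE eqxx /=; case: eqP => [->|]; last by rewrite mulr0 subr0.
by rewrite mulr1 subrr.
Qed.

(** Forgetting coordinate [j] kills only the multiples of [delta_mx 0 j], which lies in [W] exactly
    when [j] is a coloop. *)
Lemma dim_deletion j W : delta_mx 0 j \notin W -> \dim (deletion j W) = \dim W.
Proof.
move=> ej; apply: limg_dim_eq; apply/eqP; rewrite -subv0; apply/subvP => w.
rewrite memv_cap memv_ker lfunE /= zero_coordE subr_eq0 memv0 => /andP[wW /eqP wE].
have [w0|w0] := eqVneq (w 0 j) 0; first by rewrite wE w0 scale0r.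
move: (w 0 j) w0 wE => c c0 wE; case/negP: ej.
have -> : delta_mx 0 j = c^-1 *: w by rewrite wE scalerA mulVf ?scale1r.
by rewrite memvZ.
Qed.

Lemma deletion_coloop j W : delta_mx 0 j \in W -> deletion j W = contraction j W.
Proof.
move=> ej; apply/vspaceP => v; apply/deletionP/idP => [[w wW ->]|].
  by rewrite contractionP zero_coordE memvB ?memvZ //= !mxE !eqxx mulr1 subrr.
rewrite contractionP => /andP[vW /eqP v0]; exists v => //.
by rewrite zero_coord0.
Qed.

Lemma nonloops_deletion j W : ~~ loop W j ->
  (#|[pred i | ~~ loop (deletion j W) i]| < #|[pred i | ~~ loop W i]|)%N.
Proof.
move=> lj; apply: proper_card; apply/properP; split.
  by apply/subsetP => i; rewrite !inE loop_deletion negb_or => /andP[].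
by exists j; rewrite !inE // loop_deletion eqxx.
Qed.

Lemma nonloops_contraction j W : ~~ loop W j ->
  (#|[pred i | ~~ loop (contraction j W) i]| < #|[pred i | ~~ loop W i]|)%N.
Proof.
move=> lj; apply: leq_ltn_trans (nonloops_deletion lj); apply: subset_leq_card.
apply/subsetP => i; rewrite !inE loop_deletion; apply: contra.
exact: loop_contraction.
Qed.

Lemma arr_ideal_loop W i : loop W i -> arr_ideal W 'X_i.
Proof. by move=> /loopP li w [wW _]; rewrite mevalXU /recip li // invr0. Qed.

Lemma generic_deletion j W w : generic W w -> generic (deletion j W) (zero_coord j w).
Proof.
move=> [wW wP]; split=> [|i]; first by apply/deletionP; exists w.
by rewrite loop_deletion negb_or mxE => /andP[/negPf ->] /wP.
Qed.

Lemma meval_zero_coord j f w : var_free j f -> f.@[recip (zero_coord j w)] = f.@[recip w].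
Proof.
by move=> fT; apply: (var_free_meval fT) => i ij; rewrite /recip mxE (negPf ij).
Qed.

Lemma arr_ideal_low j W f : var_free j f -> arr_ideal (deletion j W) f -> arr_ideal W f.
Proof.
by move=> fT If w gw; rewrite -(meval_zero_coord w fT) If //; apply: generic_deletion.
Qed.

(** A generic vector of the deletion may lift only to a vector with coordinate [j] equal to 0, so
    even for [f] free of [y] the limit is taken, with k = 0. *)
Lemma arr_ideal_lead0 j W f : ~~ loop W j -> var_free j f ->
  arr_ideal W f -> arr_ideal (deletion j W) f.
Proof.
move=> lj fT If _ [/deletionP[w wW ->] wP].
rewrite meval_zero_coord //.
have := @arr_ideal_lead W j 0 (fun=> f) w lj (fun=> fT) wW.
rewrite !big_ord_recl !big_ord0 !expr0 !mul1r !addr0; apply=> // i ij li.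
have := wP i; rewrite loop_deletion negb_or ij li mxE (negPf ij); exact.
Qed.

(** At coordinate [j] equal to 0 every term of [arr_ideal_lead] but the leading one vanishes. The
    second hypothesis, that no other nonloop is parallel to [j], keeps the other coordinates
    nonzero. *)
Lemma arr_ideal_lead_contraction j W k (c : nat -> V) : ~~ loop W j ->
  (forall i, i != j -> loop (contraction j W) i -> loop W i) ->
  (forall i, var_free j (c i)) ->
  arr_ideal W (\sum_(i < k.+2) 'X_j ^+ i * c i) ->
  arr_ideal (contraction j W) (c k.+1).
Proof.
move=> lj np cT If w [wW wP]; move: wW; rewrite contractionP => /andP[wW /eqP w0].
have := arr_ideal_lead lj cT wW _ If; rewrite big_ord_recr /= subnn expr0 mul1r.
rewrite w0 big1 ?add0r => [|i _]; last by rewrite subSn ?exprS ?mul0r // -ltnS.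
by apply=> i ij li; apply: wP; apply: contra li; apply: np.
Qed.

End Arrangement.

(** * Generation of the relations by circuits *)

Section Circuits.
Variables (K : numClosedFieldType) (n : nat).
Local Notation V := {mpoly K[n.+1]}.
Local Notation E := 'rV[K]_n.+1.
Implicit Types (W : {vspace E}) (w v : E) (f g : V) (j : 'I_n.+1) (S : {set 'I_n.+1}).

Definition circuit_poly (c : 'I_n.+1 -> K) (S : {set 'I_n.+1}) : V :=
  \sum_(i in S) c i *: \prod_(k in S :\ i) 'X_k.

Definition circuit_gen W g :=
  (exists2 i, loop W i & g = 'X_i) \/
  exists c (S : {set 'I_n.+1}), [/\ forall i, i \in S -> ~~ loop W i,
    forall w, w \in W -> \sum_(i in S) c i * w 0 i = 0 & g = circuit_poly c S].

Definition circuit_ideal W := ideal_gen (circuit_gen W).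

Lemma circuit_gen_arr W g : circuit_gen W g -> arr_ideal W g.
Proof.
case=> [[i li ->]|[c [S [Sl Sc ->]]] w [wW wP]]; first exact: arr_ideal_loop.
rewrite raddf_sum /=.
have -> : \sum_(i in S) (c i *: \prod_(k in S :\ i) 'X_k).@[recip w] =
    (\prod_(k in S) recip w k) * \sum_(i in S) c i * w 0 i.
  rewrite mulr_sumr; apply: eq_bigr => i iS.
  rewrite mevalZ rmorph_prod /= (big_setD1 i iS) /= mulrCA; congr (_ * _).
  rewrite mulrAC [recip w i * _]mulVf ?mul1r; last exact/wP/Sl.
  by apply: eq_bigr => k _; rewrite mevalXU.
by rewrite Sc // mulr0.
Qed.

Lemma circuit_ideal_arr W g : circuit_ideal W g -> arr_ideal W g.
Proof.
have hI := arr_ideal_hid W.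
elim/ideal_gen_ind => [|f h|f h /circuit_gen_arr]; [exact: hid0|exact: hidD|].
exact: hidM.
Qed.

Lemma var_free_var j i : i != j -> var_free j ('X_i : V).
Proof. by move=> ij; rewrite /var_free kill_varX mnm1E (negPf ij). Qed.

Lemma kill_var_prod j (S : {set 'I_n.+1}) : j \notin S ->
  var_free j (\prod_(k in S) 'X_k : V).
Proof.
move=> jS; apply: big_ind => [|f g|k kS].
- exact: rmorph1.
- exact: var_freeM.
- by apply: var_free_var; apply: contraNneq jS => <-.
Qed.

Lemma var_free_circuit_poly j c S : j \notin S -> var_free j (circuit_poly c S).
Proof.
move=> jS; apply: big_ind => [|f g|k kS]; first exact: var_free0.
  exact: var_freeD.
apply: var_freeZ; apply: kill_var_prod.
by apply: contra jS; rewrite inE => /andP[].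
Qed.

Lemma circuit_poly_setU1 j c (a : K) (S : {set 'I_n.+1}) : j \notin S ->
  circuit_poly (fun i => if i == j then a else c i) (j |: S) =
  'X_j * circuit_poly c S + a *: \prod_(k in S) 'X_k.
Proof.
move=> jS; rewrite /circuit_poly big_setU1 //= eqxx setU1K // addrC; congr (_ + _).
rewrite mulr_sumr; apply: eq_bigr => i iS.
have ij : i != j by apply: contraNneq jS => <-.
rewrite (negPf ij) -scalerAr; congr (_ *: _).
have -> : (j |: S) :\ i = j |: (S :\ i).
  by apply/setP => k; rewrite !inE; case: eqP => [->|//]; rewrite (negPf ij).
by rewrite big_setU1 // inE negb_and jS orbT.
Qed.

Section Nonparallel.
Variables (W : {vspace E}) (j : 'I_n.+1).
Hypothesis lj : ~~ loop W j.
Hypothesis np : forall i, i != j -> loop (contraction j W) i -> loop W i.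

(** A linear relation on the hyperplane [contraction j W] extends to [W] by a term in coordinate
    [j]. The circuit polynomial of the extension is y times the old one plus a monomial free of
    [y]. *)
Lemma circuit_push g : circuit_ideal (contraction j W) g ->
  exists2 t, var_free j t & circuit_ideal W ('X_j * kill_var j g + t).
Proof.
elim/ideal_gen_ind => [|f h [t tT Ct] [s sT Cs]|f h].
- exists 0; first exact: var_free0.
  by rewrite /kill_var raddf0 mulr0 addr0; apply: ideal_gen0.
- exists (t + s); first exact: var_freeD.
  rewrite kill_varD (_ : _ + _ = ('X_j * kill_var j f + t) + ('X_j * kill_var j h + s)).
    exact: ideal_genD.
  ring.
suff main h0 : circuit_gen (contraction j W) h0 ->
    exists2 t, var_free j t & circuit_ideal W ('X_j * kill_var j h0 + t).
  case/main => t tT Ct; exists (kill_var j f * t).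
    by apply: var_freeM => //; apply: kill_var_free.
  rewrite kill_varM (_ : _ + _ = kill_var j f * ('X_j * kill_var j h + t)).
    exact: ideal_genM.
  ring.
case=> [[i li ->]|[c [S [Sl Sc ->]]]].
  exists 0; first exact: var_free0.
  rewrite addr0; have [->|ij] := eqVneq i j.
    by rewrite kill_var_y mulr0; apply: ideal_gen0.
  rewrite var_free_var //; apply: ideal_genM; apply: ideal_gen_mem.
  by left; exists i => //; apply: np.
have jS : j \notin S.
  by apply/negP => /Sl /negP; apply; apply: loop_contraction; rewrite eqxx.
have [v vW vj] := nloopP lj.
(* The coefficient that makes the extended relation hold at [v]; since [v] and the contraction span
   [W], it then holds on [W]. *)
pose a := - (\sum_(i in S) c i * v 0 i) / v 0 j.
exists (a *: \prod_(k in S) 'X_k); first by apply: var_freeZ; apply: kill_var_prod.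
rewrite (var_free_circuit_poly c jS) -circuit_poly_setU1 //.
apply: ideal_gen_mem; right.
exists (fun i => if i == j then a else c i), (j |: S); split=> // [i|w wW].
  rewrite !inE => /predU1P[-> //|/Sl]; apply: contra => li.
  by apply: loop_contraction; rewrite li orbT.
rewrite big_setU1 //= eqxx.
have w'W : w - (w 0 j / v 0 j) *: v \in contraction j W.
  by rewrite contractionP memvB ?memvZ //= !mxE divfK // subrr.
have e : \sum_(i in S) c i * w 0 i = w 0 j / v 0 j * \sum_(i in S) c i * v 0 i.
  apply/eqP; rewrite -subr_eq0 mulr_sumr -sumrB; apply/eqP.
  by apply: etrans (Sc _ w'W); apply: eq_bigr => i _; rewrite !mxE; ring.
have -> : \sum_(i in S) (if i == j then a else c i) * w 0 i = \sum_(i in S) c i * w 0 i.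
  apply: eq_bigr => i iS; case: eqP => // ij.
  by move: jS; rewrite -ij iS.
rewrite e /a; field.
exact: vj.
Qed.

Lemma circuit_gen_deletion g : circuit_gen (deletion j W) g ->
  circuit_ideal W (kill_var j g).
Proof.
case=> [[i li ->]|[c [S [Sl Sc ->]]]].
  move: li; rewrite loop_deletion; have [-> _|ij /= li] := eqVneq i j.
    by rewrite kill_var_y; apply: ideal_gen0.
  by rewrite var_free_var //; apply: ideal_gen_mem; left; exists i.
have jS : j \notin S by apply/negP => /Sl; rewrite loop_deletion eqxx.
rewrite (var_free_circuit_poly c jS); apply: ideal_gen_mem; right.
exists c, S; split=> // [i /Sl|w wW]; first by rewrite loop_deletion negb_or => /andP[].
have w'W : zero_coord j w \in deletion j W by apply/deletionP; exists w.
apply: etrans (Sc _ w'W).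
apply: eq_bigr => i iS; rewrite mxE; case: eqP => // ij.
by move: jS; rewrite -ij iS.
Qed.

End Nonparallel.

Lemma circuit_deletion W j f : var_free j f ->
  circuit_ideal (deletion j W) f -> circuit_ideal W f.
Proof.
move=> fT Cf; rewrite -fT; move: f Cf {fT}.
apply: ideal_gen_ind => [|f g|f g Gg].
- by rewrite /kill_var raddf0; apply: ideal_gen0.
- by rewrite kill_varD; apply: ideal_genD.
- by rewrite kill_varM; apply: ideal_genM; apply: circuit_gen_deletion.
Qed.

Lemma glued_nonparallel W j : ~~ loop W j ->
  (forall i, i != j -> loop (contraction j W) i -> loop W i) ->
  (forall f, arr_ideal (contraction j W) f -> circuit_ideal (contraction j W) f) ->
  glued j (arr_ideal W) (arr_ideal (deletion j W)) (arr_ideal (contraction j W)).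
Proof.
move=> lj np IC; split; try exact: arr_ideal_hid.
- by apply: arr_ideal_loop; rewrite loop_deletion eqxx.
- by apply: arr_ideal_loop; apply: loop_contraction; rewrite eqxx.
- move=> [|k] c cT If.
    apply: arr_ideal_lead0 => //.
    by move: If; rewrite big_ord_recl big_ord0 expr0 mul1r addr0.
  exact: arr_ideal_lead_contraction If.
- by move=> f fT; apply: arr_ideal_low.
- move=> g gT /IC /(circuit_push lj np)[t tT Ct]; exists t => //.
  by rewrite -{1}gT; apply: circuit_ideal_arr.
Qed.

(** The leading coefficient in [y] lies in the contraction ideal, so [circuit_push] gives a
    combination of circuits with the same leading term. Subtracting lowers the degree in [y], and
    the part free of [y] belongs to the deletion. *)
Lemma circuit_complete_step W j : ~~ loop W j ->
  (forall i, i != j -> loop (contraction j W) i -> loop W i) ->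
  (forall f, arr_ideal (contraction j W) f -> circuit_ideal (contraction j W) f) ->
  (forall f, arr_ideal (deletion j W) f -> circuit_ideal (deletion j W) f) ->
  forall f, arr_ideal W f -> circuit_ideal W f.
Proof.
move=> lj np IC'' IC' f; have [m0 /(_ _ (leqnn _))[c cT fE]] := var_expansion j f.
elim: m0 c f cT fE => [|m IH] c f cT fE If.
  move: fE; rewrite big_ord_recl big_ord0 expr0 mul1r addr0 => fE.
  apply: (@circuit_deletion W j); first by rewrite fE.
  by apply: IC'; apply: arr_ideal_lead0 => //; rewrite fE.
have Ic : arr_ideal (contraction j W) (c m.+1).
  by apply: (arr_ideal_lead_contraction lj np cT); rewrite -fE.
have [t tT Ct] := circuit_push lj np (IC'' _ Ic); rewrite cT in Ct.
have Cm := ideal_genM ('X_j ^+ m) Ct.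
set g := _ * _ in Cm.
rewrite -[f](subrK g); apply: ideal_genD => //.
apply: (IH (fun i => if i == m then c m - t else c i)) => [i||].
- by case: ifP => _ //; apply: var_freeB.
- rewrite fE !big_ord_recr /= eqxx /g.
  have -> : \sum_(i < m) 'X_j ^+ i * (if i == m :> nat then c m - t else c i) =
      \sum_(i < m) 'X_j ^+ i * c i.
    by apply: eq_bigr => i _; have := ltn_ord i; case: eqP => // ->; rewrite ltnn.
  by rewrite exprS; ring.
- by apply: (hidB (arr_ideal_hid W)) => //; apply: circuit_ideal_arr.
Qed.

Lemma nullary_circuits W f : (forall i, loop W i) -> circuit_ideal W (f - f.@[fun=> 0]%:MP).
Proof.
move=> lW; elim/mpolyind: f => [|c m p _ _ IH].
  by rewrite meval0 mpolyC0 subr0; apply: ideal_gen0.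
rewrite mevalD mevalZ mpolyCD mpolyCM opprD addrACA; apply: ideal_genD => //.
rewrite -mul_mpolyC -mulrBr; apply: ideal_genM.
have [->|m0] := eqVneq m 0%MM; first by rewrite mpolyX0 meval1 mpolyC1 subrr; apply: ideal_gen0.
have [i mi] : exists i, m i != 0%N.
  apply: contrapT => /forallNP H; move/eqP: m0; apply; apply/mnmP => i.
  by rewrite mnm0E; apply/eqP; apply: contrapT => /negP; apply: H.
have -> : 'X_[m].@[fun=> 0] = 0 :> K.
  by rewrite mevalX (bigD1 i) //= expr0n (negPf mi) mul0r.
rewrite mpolyC0 subr0.
have -> : m = (m - U_(i) + U_(i))%MM by rewrite submK // lep1mP.
by rewrite mpolyXD; apply: ideal_genM; apply: ideal_gen_mem; left; exists i.
Qed.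

End Circuits.

(** * Generators and regular sequences by deletion and contraction *)

Section Structure.
Variables (K : numClosedFieldType) (n : nat).
Local Notation V := {mpoly K[n.+1]}.
Local Notation E := 'rV[K]_n.+1.
Implicit Types (W : {vspace E}) (w v : E) (f g : V) (j : 'I_n.+1) (J : V -> Prop) (s : seq V).

Lemma mem_pencil s s' (c : K) t : t \in pencil s s' c ->
  exists a b, [/\ a \in s, b \in s' & t = a + c *: b].
Proof.
elim: s s' => [|a s IH] [|b s'] //; rewrite [pencil _ _ _]/= inE => /predU1P[->|].
  by exists a, b; rewrite !mem_head.
by case/IH => a' [b' [as' bs' ->]]; exists a', b'; rewrite !inE as' bs' !orbT.
Qed.

Lemma pencil_rcons s s' a b (c : K) : size s = size s' ->
  pencil (rcons s a) (rcons s' b) c = rcons (pencil s s' c) (a + c *: b).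
Proof. by move=> ss; rewrite /pencil zip_rcons // map_rcons. Qed.

(** On [W] coordinate [i] is c times coordinate [j], so the variable of [j] is congruent to c times
    that of [i]. Hence every multiple of [y] is congruent to something free of [y], and the unit
    ideal takes the place of the contraction. *)
Lemma glued_parallel W j i : ~~ loop W j -> i != j -> ~~ loop W i ->
  loop (contraction j W) i ->
  exists2 c : K, circuit_ideal W ('X_j - c *: 'X_i) &
  glued j (arr_ideal W) (arr_ideal (deletion j W)) (fun=> True).
Proof.
move=> lj ij li lci; have [v vW vj] := nloopP lj.
pose c := v 0 i / v 0 j.
have wc w : w \in W -> w 0 i = c * w 0 j.
  move=> wW; have /loopP/(_ (w - (w 0 j / v 0 j) *: v)) := lci.
  rewrite contractionP memvB ?memvZ //= !mxE divfK // subrr eqxx => /(_ isT)/eqP.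
  by rewrite subr_eq0 => /eqP ->; rewrite /c; ring.
have Cij : circuit_ideal W ('X_j - c *: 'X_i).
  apply: ideal_gen_mem; right.
  exists (fun k => if k == j then - c else 1), [set i; j]; split.
  - by move=> k; rewrite !inE => /orP[] /eqP ->.
  - by move=> w wW; rewrite big_setU1 ?inE //= big_set1 (negPf ij) eqxx (wc w) //; ring.
  - rewrite /circuit_poly big_setU1 ?inE //= big_set1 (negPf ij) eqxx.
    have -> : [set i; j] :\ i = [set j].
      by apply/setP => k; rewrite !inE; case: eqP => [->|//]; rewrite (negPf ij).
    have -> : [set i; j] :\ j = [set i].
      apply/setP => k; rewrite !inE; case: eqP => [->|_]; last by rewrite orbF.
      by rewrite eq_sym (negPf ij).
    by rewrite !big_set1 scale1r scaleNr.
exists c => //; split=> //; try exact: arr_ideal_hid.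
- by apply: arr_ideal_loop; rewrite loop_deletion eqxx.
- move=> [|k] d dT If //; apply: arr_ideal_lead0 => //.
  by move: If; rewrite big_ord_recl big_ord0 expr0 mul1r addr0.
- by move=> f fT; apply: arr_ideal_low.
- move=> g gT _; exists (- (c *: 'X_i * g)).
    rewrite -sub0r; apply: var_freeB; first exact: var_free0.
    by apply: var_freeM => //; apply: var_freeZ; apply: var_free_var.
  rewrite -mulrBl; apply: (hidMr _ (arr_ideal_hid W)).
  exact: circuit_ideal_arr.
Qed.

Lemma linear_subst_any j (x f : V) : x \is 1.-homog -> var_free j x ->
  exists g h, var_free j g /\ f = g + ('X_j - x) * h.
Proof.
move=> x1 xT; have [k ->] := pihomog_sum f.
elim/big_ind: _ => [|_ _ [g [h [gT ->]]] [g' [h' [gT' ->]]]|d _].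
- by exists 0, 0; rewrite mulr0 addr0; split => //; apply: var_free0.
- by exists (g + g'), (h + h'); split; [apply: var_freeD|ring].
- have [g [h [gT _ e]]] := linear_subst x1 xT (pihomogP mdeg d f).
  by exists g, h.
Qed.

(** Both claims are carried through one induction, as gluing uses the circuits of the contraction.
    The forms avoid the loop variables so that those for the deletion of [j] are free of [y].
    [maxn 1] covers rank 0, where the ring is [K] in degree 0 and vanishes only from degree 1 on. *)
Definition arr_structure W :=
  (forall f, arr_ideal W f -> circuit_ideal W f) /\
  exists s, [/\ size s = \dim W, linear_forms s,
    forall i t, loop W i -> t \in s -> var_free i t,
    regs (arr_ideal W) s & spans (adds (arr_ideal W) s) (maxn 1 (\dim W))].

Lemma arr_structure_trivial W : (forall i, loop W i) -> arr_structure W.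
Proof.
move=> lW; have W0 : W = 0%VS.
  apply/eqP; rewrite -subv0; apply/subvP => w wW; rewrite memv0; apply/eqP/rowP => i.
  by have /loopP -> := lW i; rewrite ?mxE.
have g0 : generic W 0 by split=> [|i]; rewrite ?mem0v ?lW.
have r0 f : f.@[recip (0 : E)] = f.@[fun=> 0].
  by apply: meval_eq => i; rewrite /recip mxE invr0.
split=> [f If|].
  have := nullary_circuits f lW; rewrite -r0 (If 0 g0) mpolyC0 subr0; exact.
exists [::]; split=> //; first by rewrite W0 dimv0.
rewrite W0 dimv0 => f f1 w [wW _].
move: wW; rewrite memv0 => /eqP ->.
have := meval_homogZ 0 (fun=> 0) f1; rewrite expr1 mul0r => e; rewrite r0.
by rewrite e mul0r.
Qed.

Lemma arr_structure_parallel W j i : ~~ loop W j -> i != j -> ~~ loop W i ->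
  loop (contraction j W) i -> delta_mx 0 j \notin W ->
  arr_structure (deletion j W) -> arr_structure W.
Proof.
move=> lj ij li lci ej [IC [s [ss s1 sT rs sp]]].
have [c Cij gl] := glued_parallel lj ij li lci.
have x1 : (c *: 'X_i : V) \is 1.-homog by rewrite dhomogZ ?homog_var.
have xT : var_free j (c *: 'X_i : V) by apply: var_freeZ; apply: var_free_var.
split=> [f If|].
  have [g [h [gT fE]]] := linear_subst_any f x1 xT.
  rewrite fE; apply: ideal_genD; last by rewrite mulrC; apply: ideal_genM.
  apply: (@circuit_deletion _ _ _ j) => //; apply: IC; apply: arr_ideal_lead0 => //.
  have -> : g = f - ('X_j - c *: 'X_i) * h by rewrite fE addrK.
  apply: (hidB (arr_ideal_hid W)) => //; apply: (hidMr _ (arr_ideal_hid W)).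
  exact: circuit_ideal_arr.
rewrite dim_deletion // in ss sp.
have sTj t : t \in s -> var_free j t by apply: sT; rewrite loop_deletion eqxx.
have [|rs' gls] := glued_adds gl s1 sTj rs.
  (* Modulo the unit ideal every sequence is regular. *)
  suff H u : (forall f, u f) -> regs u s by apply: H.
  elim: s {ss s1 sT rs sp sTj} u => //= t s IH u ut; split; first by move=> f _.
  by apply: IH => f; apply: sub_addl.
exists s; split=> //.
  by move=> k t lk; apply: sT; rewrite loop_deletion lk orbT.
apply: (spans_subst (adds_hid (arr_ideal_hid W) s1) x1 xT).
  by move=> f fT fN; apply: (glued_low gls) => //; apply: sp.
by apply: sub_adds; apply: circuit_ideal_arr.
Qed.

(** Deletion and contraction coincide, so [y] is a free polynomial variable over the ring of the
    deletion; it is appended to the sequence. *)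
Lemma arr_structure_coloop W j : ~~ loop W j -> delta_mx 0 j \in W ->
  arr_structure (deletion j W) -> arr_structure W.
Proof.
move=> lj ej [IC [s [ss s1 sT rs sp]]].
have DC := deletion_coloop ej.
have np i : i != j -> loop (contraction j W) i -> loop W i.
  by rewrite -DC loop_deletion => /negPf ->.
have IC'' f : arr_ideal (contraction j W) f -> circuit_ideal (contraction j W) f.
  by rewrite -DC; apply: IC.
have gl := glued_nonparallel lj np IC''; rewrite -DC in gl.
split; first exact: circuit_complete_step IC'' IC.
have sTj t : t \in s -> var_free j t by apply: sT; rewrite loop_deletion eqxx.
have [rs' gls] := glued_adds gl s1 sTj rs rs.
have [ry sy] := glued_free_variable gls (fun f => id) sp.
have dW : (\dim (deletion j W)).+1 = \dim W by rewrite DC dim_contraction.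
exists (rcons s 'X_j); split.
- by rewrite size_rcons ss.
- by rewrite linear_forms_rcons homog_var.
- move=> k t lk; rewrite mem_rcons inE => /predU1P[->|ts].
    by apply: var_free_var; apply: contraNneq lj => ->.
  by apply: sT ts; rewrite loop_deletion lk orbT.
- by rewrite regs_rcons.
- rewrite adds_rcons; apply: (spans_le _ _ sy); last first.
    by rewrite geq_max leq_maxl /= -dW leq_max leqnSn orbT.
  by apply: addl_hid; [apply: adds_hid => //; apply: arr_ideal_hid|apply: homog_var].
Qed.

(** With s' = u0, x for the deletion and s'' for the contraction, a generic combination [u] of u0
    and s'' is such that u, x still fills degree r + 1 modulo the deletion ideal and [u] fills
    degree r modulo the contraction ideal. Exchange makes both regular, and [glued_last] replaces
    [x] by a form regular for [W]. *)
Lemma arr_structure_generic W j : ~~ loop W j -> delta_mx 0 j \notin W ->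
  (forall i, i != j -> loop (contraction j W) i -> loop W i) ->
  arr_structure (deletion j W) -> arr_structure (contraction j W) -> arr_structure W.
Proof.
move=> lj ej np [IC' [s' [ss' s1' sT' rs' sp']]] [IC'' [s'' [ss'' s1'' sT'' rs'' sp'']]].
have gl := glued_nonparallel lj np IC''.
split; first exact: circuit_complete_step IC'' IC'.
have dW := dim_contraction lj.
rewrite dim_deletion // in ss' sp'.
(* If the contraction were 0, all other coordinates would be loops of it and hence of [W], which
   would make [j] a coloop. *)
have d2 : (0 < \dim (contraction j W))%N.
  rewrite lt0n; apply/negP; rewrite dimv_eq0 => /eqP C0.
  have [v vW vj] := nloopP lj.
  have [i ij vi] : exists2 i, i != j & v 0 i != 0.
    apply: contrapT => nv; move/negP: ej; apply.
    have -> : delta_mx 0 j = (v 0 j)^-1 *: v; last by rewrite memvZ.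
    apply/rowP => i; rewrite !mxE eqxx /=; case: eqP => [->|/eqP ij]; first by rewrite mulVf.
    apply/esym/eqP; rewrite mulf_eq0; apply/orP; right.
    by apply: contrapT => /negP vi; apply: nv; exists i.
  have /loopP/(_ v vW) v0 : loop W i.
    by apply: np => //; apply/loopP => w; rewrite C0 memv0 => /eqP ->; rewrite mxE.
  by rewrite v0 eqxx in vi.
have e1 : maxn 1 (\dim W) = \dim W by apply/maxn_idPr; rewrite -dW.
have e2 : maxn 1 (\dim (contraction j W)) = \dim (contraction j W) by apply/maxn_idPr.
rewrite e1 in sp' *; rewrite e2 in sp''.
set r := \dim (contraction j W) in dW d2 e2 sp'' ss''.
have hI' := arr_ideal_hid (deletion j W); have hI'' := arr_ideal_hid (contraction j W).
case/lastP: s' ss' s1' sT' rs' sp' => [|u0 x]; first by rewrite -dW.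
rewrite size_rcons -dW => -[su0] s1' sT' rs' sp'.
have /andP[x1 u01] : (x \is 1.-homog) && linear_forms u0 by rewrite -linear_forms_rcons.
(* Padding [s''] with 0 equalises the lengths and leaves the last form [x] unchanged along the
   pencil. *)
have s01 : linear_forms (rcons s'' (0 : V)) by rewrite linear_forms_rcons rpred0.
have szu : size u0 = size s'' by rewrite su0 ss''.
have [|bad1 badP1] := spans_pencil hI' s1' s01 _ sp'; first by rewrite !size_rcons szu.
have [bad2 badP2] := spans_pencil hI'' s1'' u01 (esym szu) sp''.
have [t] := exists_notin (0 :: bad1 ++ [seq d^-1 | d <- bad2]).
rewrite inE mem_cat !negb_or => /and3P[t0 tb1 tb2].
pose u := pencil u0 s'' t.
have u1 : linear_forms u by apply: linear_forms_pencil.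
have su : size u = r by rewrite size_pencil.
have spu' : spans (adds (arr_ideal (deletion j W)) (rcons u x)) r.+1.
  by have := badP1 t tb1; rewrite pencil_rcons // scaler0 addr0.
have spu'' : spans (adds (arr_ideal (contraction j W)) u) r.
  apply: spans_pencil_swap => //; apply: badP2.
  by apply: contra tb2 => tb; apply/mapP; exists t^-1; rewrite ?invrK.
have rsu' : regs (arr_ideal (deletion j W)) (rcons u x).
  apply: (regs_exchange hI' s1' _ _ rs' sp' spu').
    by rewrite linear_forms_rcons x1.
  by rewrite !size_rcons su su0.
have rsu'' : regs (arr_ideal (contraction j W)) u.
  by apply: (regs_exchange hI'' s1'' u1 _ rs'' sp'' spu''); rewrite su.
have uT i f : (i == j) || loop W i -> f \in rcons u x -> var_free i f.
  move=> li; rewrite mem_rcons inE => /predU1P[->|/mem_pencil[a [b [au bs ->]]]].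
    by apply: sT'; rewrite ?loop_deletion // mem_rcons mem_head.
  apply: var_freeD; first by apply: sT'; rewrite ?loop_deletion // mem_rcons inE au orbT.
  by apply: var_freeZ; apply: sT'' bs; apply: loop_contraction.
have /regs_rcons[rsu rx] := rsu'.
have [|rsW gls] := glued_adds gl u1 _ rsu rsu''.
  by move=> v vu; apply: uT; rewrite ?eqxx // mem_rcons inE vu orbT.
have xT : var_free j x by apply: uT; rewrite ?eqxx // mem_rcons mem_head.
rewrite adds_rcons in spu'.
have [a a0 [rz sz]] := glued_last gls x1 xT rx spu' spu''.
have z1 : (x + a *: 'X_j : V) \is 1.-homog.
  by rewrite dhomogD ?dhomogZ ?homog_var.
exists (rcons u (x + a *: 'X_j)); split.
- by rewrite size_rcons su.
- by rewrite linear_forms_rcons z1.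
- move=> k v lk; rewrite mem_rcons inE => /predU1P[->|vu].
    apply: var_freeD; first by apply: uT; rewrite ?lk ?orbT // mem_rcons mem_head.
    by apply: var_freeZ; apply: var_free_var; apply: contraNneq lj => ->.
  by apply: uT; rewrite ?lk ?orbT // mem_rcons inE vu orbT.
- by rewrite regs_rcons.
- by rewrite adds_rcons.
Qed.

(* The contraction of a nonloop j is an arrangement with parallel elements in
   general; if j is itself parallel to another element, deleting j does not
   change the coordinate ring. *)
Theorem arr_structure_all W : arr_structure W.
Proof.
move: {2}#|_| (leqnn #|[pred i | ~~ loop W i]|) => k.
elim: k W => [|k IH] W Wk.
  apply: arr_structure_trivial => i; apply: contrapT => /negP li.
  move: Wk; rewrite leqn0 => /eqP/card0_eq/(_ i); by rewrite !inE li.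
have [lW|] := pselect (forall i, loop W i); first exact: arr_structure_trivial.
move=> /existsNP[j /negP lj].
have SD : arr_structure (deletion j W).
  by apply: IH; rewrite -ltnS (leq_trans (nonloops_deletion lj)).
have SC : arr_structure (contraction j W).
  by apply: IH; rewrite -ltnS (leq_trans (nonloops_contraction lj)).
have [ej|ej] := boolP (delta_mx 0 j \in W); first exact: arr_structure_coloop SD.
have [[i [ij li lci]]|np] := pselect (exists i, [/\ i != j, ~~ loop W i & loop (contraction j W) i]).
  exact: (arr_structure_parallel lj ij li lci ej SD).
apply: arr_structure_generic SC => // i ij lci.
by apply: contrapT => /negP li; apply: np; exists i.
Qed.

End Structure.

(** * Reciprocal linear spaces *)

Section HilbertFunctionDef.
Variables (K : numClosedFieldType) (n : nat).
Local Notation V := {mpoly K[n.+1]}.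
Local Notation piece q := (dhomog n.+1 K q).
Implicit Types (J : V -> Prop).

Lemma hilbert_function_hf J q : homogeneous_ideal J -> hilbert_function J q (hf J q).
Proof.
move=> hJ; pose C := (hpiece J q)^C%VS.
have dC : \dim C = hf J q by rewrite dimv_compl dimvf.
rewrite -dC; exists (fun i => val (vbasis C)`_i); split=> [i|v vq|c Jc i].
- exact: valP.
- have : to_piece q v \in (hpiece J q + C)%VS by rewrite addv_complf memvf.
  case/memv_addP => a aJ [d dC' vE]; exists (fun i => coord (vbasis C) i d).
  have -> : v - \sum_i coord (vbasis C) i d *: val (vbasis C)`_i = val a.
    rewrite -[v in LHS](to_pieceK vq) vE.
    have {1}-> := coord_vbasis dC'.
    by rewrite raddfD /= raddf_sum /= addrK.
  exact/(hpieceP _ hJ).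
- have : \sum_i c i *: (vbasis C)`_i \in (hpiece J q :&: C)%VS.
    rewrite memv_cap; apply/andP; split.
      by apply/(hpieceP _ hJ); rewrite raddf_sum.
    by apply: memv_suml => k _; rewrite memvZ // vbasis_mem // memt_nth.
  rewrite capv_compl memv0 => /eqP c0.
  by have /freeP := basis_free (vbasisP C); apply.
Qed.

Lemma hilbert_function_unique J q h : homogeneous_ideal J ->
  hilbert_function J q h -> h = hf J q.
Proof.
move=> hJ [b [bq bgen bfree]]; pose X := [tuple to_piece q (b i) | i < h].
have valsum (c : 'I_h -> K) : val (\sum_i c i *: X`_i) = \sum_i c i *: b i.
  rewrite raddf_sum /=; apply: eq_bigr => i _.
  by rewrite (nth_mktuple _ 0 i) /= pihomog_dE.
have fX : free X.
  apply/freeP => c c0 i; apply: bfree; rewrite -valsum c0.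
  exact: hid0.
have dX : \dim <<X>> = h by move: fX; rewrite /free size_tuple => /eqP.
have capX : (<<X>> :&: hpiece J q = 0)%VS.
  apply/eqP; rewrite -subv0; apply/subvP => u; rewrite memv_cap memv0.
  move=> /andP[uX /(hpieceP _ hJ) Ju]; rewrite (coord_span uX) in Ju *.
  rewrite valsum in Ju; rewrite big1 // => i _.
  by rewrite (bfree _ Ju i) scale0r.
have addX : (<<X>> + hpiece J q = fullv)%VS.
  apply/vspaceP => u; rewrite memvf; have [c Jc] := bgen _ (valP u).
  rewrite -[u](subrK (\sum_i c i *: X`_i)) addrC; apply: memv_add.
    apply: memv_suml => i _; by rewrite memvZ // memv_span // memt_nth.
  by apply/(hpieceP _ hJ); rewrite raddfB /= -/(val _) valsum.
have := dimv_sum_cap <<X>> (hpiece J q).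
by rewrite addX capX dimvf dimv0 dX addn0 /hf => ->; rewrite addnK.
Qed.

End HilbertFunctionDef.

(** * Linear equations of a subspace *)

Section LinearEquations.
Variables (K : numClosedFieldType) (n : nat).
Local Notation V := {mpoly K[n.+1]}.
Local Notation E := 'rV[K]_n.+1.
Local Notation piece q := (dhomog n.+1 K q).

Definition eval_basis (U : {vspace E}) (u : piece 1) : 'rV[K]_(\dim U) :=
  \row_k (val u).@[(vbasis U)`_k 0].

Fact eval_basis_linear U : linear (eval_basis U).
Proof.
by move=> c u v; apply/rowP => k; rewrite !mxE -mevalZ -mevalD.
Qed.
HB.instance Definition _ U :=
  GRing.isLinear.Build K (piece 1) 'rV[K]_(\dim U) *:%R (eval_basis U)
    (eval_basis_linear U).

Definition linear_eqs U : {vspace piece 1} := lker (linfun (eval_basis U)).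

Lemma meval_linear (f : V) (c : K) (u v : E) : f \is 1.-homog ->
  f.@[(c *: u + v) 0] = c * f.@[u 0] + f.@[v 0].
Proof.
move=> f1; rewrite [f]mpolyE !raddf_sum /= mulr_sumr -big_split /=.
apply: eq_big_seq => m mf; have dm : mdeg m = 1%N := dhomog_mf f1 mf.
have /existsP[i /eqP ->] : [exists i : 'I_n.+1, m == U_(i)%MM] by rewrite -mdeg_eq1 dm.
by rewrite !mevalZ !mevalXU !mxE; ring.
Qed.

Lemma meval_linear0 (f : V) : f \is 1.-homog -> f.@[(0 : E) 0] = 0.
Proof.
move=> f1; have := meval_linear 1 0 0 f1; rewrite scale1r addr0 mul1r => /eqP.
by rewrite -subr_eq0 opprD addNKr oppr_eq0 => /eqP.
Qed.

Lemma linear_eqsP U u : u \in linear_eqs U <-> linear_equation U (val u).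
Proof.
rewrite memv_ker lfunE /=; split=> [/eqP u0|[_ uU]].
  split=> [|v vU]; first exact: valP.
  rewrite (coord_vbasis vU); elim/big_rec: _ => [|k w _ IH].
    exact: meval_linear0 (valP u).
  rewrite meval_linear ?(valP u) // IH addr0.
  by move/rowP/(_ k): u0; rewrite !mxE => ->; rewrite mulr0.
apply/eqP/rowP => k; rewrite !mxE uU //.
by rewrite vbasis_mem // memt_nth.
Qed.

Definition linear_form (a : E) : V := \sum_i a 0 i *: 'X_i.

Lemma linear_form_homog a : linear_form a \is 1.-homog.
Proof. by apply: rpred_sum => i _; rewrite dhomogZ ?homog_var. Qed.

Lemma meval_linear_form a v : (linear_form a).@[v] = \sum_i a 0 i * v i.
Proof. by rewrite raddf_sum /=; apply: eq_bigr => i _; rewrite mevalZ mevalXU. Qed.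

Lemma dim_linear_eqs U : (\dim (linear_eqs U) + \dim U)%N = n.+1.
Proof.
have := limg_ker_dim (linfun (eval_basis U)) fullv.
rewrite capfv dimvf.
have -> : limg (linfun (eval_basis U)) = fullv.
  pose M : 'M[K]_(\dim U, n.+1) := \matrix_k (vbasis U)`_k.
  have Mfree : row_free M.
    apply: inj_row_free => v vM; apply/rowP => k; rewrite mxE.
    have /freeP := basis_free (vbasisP U); apply => //.
    move: vM; rewrite mulmx_sum_row => e; apply: etrans e.
    by apply: eq_bigr => i _; rewrite rowK.
  have /row_freeP[B MB] := Mfree.
  apply/vspaceP => u; rewrite memvf; apply/memv_imgP.
  exists (to_piece 1 (linear_form (u *m B^T))); rewrite ?memvf // lfunE /=.
  apply/rowP => k; rewrite mxE to_pieceK ?linear_form_homog // meval_linear_form.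
  have : (u *m B^T *m M^T) 0 k = u 0 k by rewrite -mulmxA -trmx_mul MB trmx1 mulmx1.
  rewrite mxE => <-; apply: eq_bigr => i _; congr (_ * _).
  by rewrite !mxE.
rewrite dimvf.
have -> : dim 'rV[K]_(\dim U) = \dim U by rewrite /dim /= mul1n.
move=> ->; rewrite /dim /=; by rewrite add1n bin1.
Qed.

(** Otherwise adding [v] to [U] would raise its dimension without losing an equation, against
    [dim_linear_eqs]. *)
Lemma mem_linear_eqs U (v : E) :
  (forall u, u \in linear_eqs U -> (val u).@[v 0] = 0) -> v \in U.
Proof.
move=> H; apply: contrapT => /negP vU.
have e : (linear_eqs U <= linear_eqs (U + <[v]>)%VS)%VS.
  apply/subvP => u uU; have /linear_eqsP[u1 u0] := uU.
  apply/linear_eqsP; split=> // _ /memv_addP[a aU [_ /vlineP[c ->] ->]].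
  by rewrite addrC meval_linear // H // u0 // mulr0 addr0.
have := dimvS e.
have lt : (\dim U < \dim (U + <[v]>))%N by exact: dim_add_line.
have := dim_linear_eqs U; have := dim_linear_eqs (U + <[v]>)%VS; lia.
Qed.

(** One point at a time: if the form vanishes at the new point, add a small multiple of a coordinate
    nonzero there, where small means outside the finite set of values spoiling earlier points. *)
Lemma avoiding_linear_form (m : nat) (p : 'I_m -> E) : (forall i, p i != 0) ->
  exists2 f : V, f \is 1.-homog & forall i, f.@[p i 0] != 0.
Proof.
move=> p0; suff [f f1 fp] : exists2 f : V, f \is 1.-homog &
    forall i, i \in index_enum 'I_m -> f.@[p i 0] != 0.
  by exists f => // i; apply: fp; rewrite mem_index_enum.
elim: (index_enum _) => [|i s [f f1 fP]]; first by exists 0; rewrite ?rpred0.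
have [fi|fi] := eqVneq (f.@[p i 0]) 0; last first.
  by exists f => // k; rewrite inE => /predU1P[->|/fP].
have [l pl] : exists l, p i 0 l != 0.
  apply: contrapT => /forallNP pl; move/negP: (p0 i); apply; apply/eqP/rowP => l.
  by rewrite mxE; apply/eqP; apply: contrapT => /negP; apply: pl.
have [t] := exists_notin (0 :: [seq - f.@[p k 0] / p k 0 l | k <- s]).
rewrite inE negb_or => /andP[t0 ts].
exists (f + t *: 'X_l); first by rewrite dhomogD ?dhomogZ ?homog_var.
move=> k; rewrite mevalD mevalZ mevalXU inE => /predU1P[->|ks].
  by rewrite fi add0r mulf_neq0.
have [pk|pk] := eqVneq (p k 0 l) 0; first by rewrite pk mulr0 addr0 fP.
apply: contra ts; rewrite addrC addr_eq0 => /eqP e.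
by apply/mapP; exists k => //; rewrite -e mulfK.
Qed.

End LinearEquations.

(** * The reciprocal linear space and its linear sections *)

Section ReciprocalSpace.
Variables (K : numClosedFieldType) (d n : nat) (L : 'M[K]_(1 + d, n.+1)).
Local Notation V := {mpoly K[n.+1]}.
Local Notation pi := (pihomog mdeg).
Hypothesis rankL : \rank L = d.+1.
Hypothesis nonconstL : forall i, exists x y : 'rV[K]_d, ell L x i <> ell L y i.

Definition row_vspace : {vspace 'rV[K]_n.+1} := limg (linfun (mulmxr L : 'rV_(1 + d) -> _)).
Local Notation W := row_vspace.

Lemma row_vspaceP w : reflect (exists u : 'rV_(1 + d), w = u *m L) (w \in W).
Proof.
apply: (iffP memv_imgP) => [[u _ ->]|[u ->]]; exists u; rewrite ?memvf // lfunE //.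
Qed.

Lemma dim_row_vspace : \dim W = d.+1.
Proof.
rewrite limg_dim_eq ?dimvf; first by rewrite /dim /= mul1n.
apply/eqP; rewrite -subv0; apply/subvP => u; rewrite memv_cap memv_ker lfunE /=.
move=> /andP[_ /eqP uL]; rewrite memv0; apply/eqP; move: uL.
rewrite -[in RHS](mul0mx _ L) => /row_free_inj; apply.
by rewrite /row_free rankL.
Qed.

Lemma ell_mem x : \row_i ell L x i \in W.
Proof.
apply/row_vspaceP; exists (row_mx 1%:M x).
by apply/rowP => i; rewrite mxE.
Qed.

Lemma nloop_row_vspace i : ~~ loop W i.
Proof.
apply/loopP => li; have [x [y]] := nonconstL i; apply.
by have := li _ (ell_mem x); have := li _ (ell_mem y); rewrite !mxE => -> ->.
Qed.

Lemma recip_image_generic x : (forall i, ell L x i != 0) -> generic W (\row_i ell L x i).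
Proof. by move=> x0; split=> [|i _]; rewrite ?ell_mem // mxE. Qed.

Lemma arr_ideal_recip_image f v : arr_ideal W f -> recip_image L v -> f.@[v 0] = 0.
Proof.
move=> If [x x0 ->]; have := If _ (recip_image_generic x0) => e; apply: etrans e.
by apply: meval_eq => i; rewrite /recip !mxE.
Qed.

(** Dividing [u] by its first entry brings it to the affine form (1, x); homogeneity of [f] absorbs
    the factor. *)
Lemma recip_image_affine k f (u : 'rV[K]_(1 + d)) : f \is k.-homog ->
  (forall v, recip_image L v -> f.@[v 0] = 0) ->
  generic W (u *m L) -> u 0 0 != 0 -> f.@[recip (u *m L)] = 0.
Proof.
move=> fk f0 [_ uP] u0; pose x : 'rV_d := (u 0 0)^-1 *: rsubmx u.
have uE : u *m L = u 0 0 *: \row_i ell L x i.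
  have -> : \row_i ell L x i = row_mx 1%:M x *m L by apply/rowP => i; rewrite mxE.
  rewrite scalemxAl; congr (_ *m L); rewrite scale_row_mx /x scalerA divff // scale1r.
  rewrite -[LHS]hsubmxK; congr row_mx; apply/rowP => i; rewrite !mxE !ord1 eqxx mulr1.
  by congr (u 0 _); apply: val_inj.
have x0 i : ell L x i != 0.
  have := uP i (nloop_row_vspace i); rewrite uE !mxE mulf_eq0 negb_or => /andP[_].
  by rewrite /ell !mxE.
have := f0 (\row_i (ell L x i)^-1); move/(_ (ex_intro2 _ _ x x0 erefl)) => e.
rewrite -[RHS](mulr0 ((u 0 0)^-1 ^+ k)) -e -(meval_homogZ _ _ fk).
apply: meval_eq => i; rewrite /recip uE [in LHS]mxE invfM; congr (_ * _).
by rewrite !mxE.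
Qed.

(** Generic vectors u L whose [u] has first entry 0 are points at infinity of the affine
    parametrisation; they are limits along the direction of the first row of [L]. *)
Lemma recip_image_arr_ideal k f : f \is k.-homog ->
  (forall v, recip_image L v -> f.@[v 0] = 0) -> arr_ideal W f.
Proof.
move=> fk f0 w gw; have [wW wP] := gw; have /row_vspaceP[u uE] := wW.
pose e : 'rV[K]_(1 + d) := delta_mx 0 0; pose v := e *m L.
have [bad badP] := line_avoids w v.
apply: (@line_limit_meval _ _ w v f (- u 0 0 :: bad)) => [i|t].
  by apply: wP; apply: nloop_row_vspace.
rewrite inE negb_or => /andP[tu tb].
have utE : w + t *: v = (u + t *: e) *m L by rewrite mulmxDl -scalemxAl uE.
rewrite utE; apply: (recip_image_affine fk f0).
  split; first by apply/row_vspaceP; exists (u + t *: e).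
  by move=> i li; rewrite -utE badP // wP.
by rewrite !mxE eqxx mulr1 addrC addr_eq0.
Qed.

Lemma recip_space_vanish f v : homogeneous f ->
  (forall v, recip_image L v -> f.@[v 0] = 0) -> recip_space L v -> f.@[v 0] = 0.
Proof.
move=> hf f0 /(_ (fun v => v != 0 /\ f.@[v 0] = 0)) [].
- exists (fun g => g = f) => [g -> //|u]; split=> [[u0 fu]|[u0 fu]].
    by split=> // g ->.
  by split=> //; apply: fu.
- move=> u iu; split; last exact: f0.
  case: iu => x x0 ->; apply/eqP => /rowP/(_ ord0); rewrite !mxE => /eqP.
  by rewrite invr_eq0 (negPf (x0 _)).
- by [].
Qed.

Lemma recip_space_neq0 v : recip_space L v -> v != 0.
Proof.
move=> /(_ (fun v => v != 0)); apply.
- by exists (fun=> False) => // u; split=> [|[]//].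
- move=> u [x x0 ->]; apply/eqP => /rowP/(_ ord0); rewrite !mxE => /eqP.
  by rewrite invr_eq0 (negPf (x0 _)).
Qed.

Lemma recip_image_sub v : recip_image L v -> recip_space L v.
Proof. by move=> iv Z _; apply. Qed.

(** This passes from the closure of an affine parametrisation to a subspace [W], which deletion and
    contraction can vary. *)
Lemma vanishing_ideal_recip : vanishing_ideal (recip_space L) = arr_ideal W.
Proof.
have hI := arr_ideal_hid W.
apply: funext => f; apply: propext; split.
  move: f; apply: ideal_gen_ind => [|f g|f g [[k gk] g0]].
  - exact: (hid0 hI).
  - exact: (hidD hI).
  - apply: (hidM hI); apply: (recip_image_arr_ideal gk) => v iv.
    by apply: g0; apply: recip_image_sub.
move=> If; have [k ->] := pihomog_sum f; rewrite /vanishing_ideal.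
apply: big_ind => [|g h|e _]; [exact: ideal_gen0|exact: ideal_genD|].
have Ie : arr_ideal W (pi e f) by apply: (hidH hI).
have he : homogeneous (pi e f) by exists e; apply: pihomogP.
apply: ideal_gen_mem; split=> // v; apply: recip_space_vanish => // u.
exact: arr_ideal_recip_image.
Qed.

Lemma nullstellensatz_recip J : homogeneous_ideal J ->
  (forall f, arr_ideal W f -> J f) ->
  (forall v, recip_space L v -> exists k f, [/\ f \is k.-homog, J f & f.@[v 0] != 0]) ->
  exists N, spans J N.
Proof.
move=> hJ IJ H; apply: contrapT => /forallNP nJ.
have [v v0 vP] := proj_nullstellensatz hJ nJ.
have [|k [f [fk Jf /eqP]]] := H v; last by apply; apply: vP fk Jf.
move=> Z [E Eh ZE] sZ; apply/ZE; split=> // f Ef.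
have [k fk] := Eh f Ef; apply: (vP k) => //; apply: IJ.
by apply: (recip_image_arr_ideal fk) => u /sZ/ZE[_]; apply.
Qed.

Variables (U : {vspace 'rV[K]_n.+1}).
Hypothesis dimU : \dim U = (n - d).+1.

Definition section_forms : seq V := [seq val u | u <- vbasis (linear_eqs U)].

Lemma linear_section_forms : linear_forms section_forms.
Proof. by apply/allP => _ /mapP[u _ ->]; apply: valP. Qed.

Lemma size_section_forms : size section_forms = d.
Proof.
rewrite size_map size_tuple; have := dim_linear_eqs U.
have : (d <= n)%N by rewrite -ltnS -rankL rank_leq_col.
by rewrite dimU; lia.
Qed.

Lemma linear_eqs_adds J u : homogeneous_ideal J ->
  u \in linear_eqs U -> adds J section_forms (val u).
Proof.
move=> hJ /coord_vbasis ->; apply/(addsP _ _ hJ).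
exists 0, (fun i => if insub i is Some k then (coord (vbasis (linear_eqs U)) k u)%:MP else 0).
split; first exact: hid0.
rewrite add0r raddf_sum /= size_map size_tuple; apply: eq_bigr => k _.
rewrite (nth_map 0) ?size_tuple // valK mulrC mul_mpolyC.
by [].
Qed.

Lemma section_ideal_recip :
  section_ideal (recip_space L) U = adds (arr_ideal W) section_forms.
Proof.
have hI := arr_ideal_hid W; have hA := adds_hid hI linear_section_forms.
apply: funext => f; apply: propext; rewrite /section_ideal vanishing_ideal_recip; split.
  move=> [g Gg Ifg]; rewrite -[f](subrK g); apply: (hidD hA); first exact: sub_adds.
  move: g Gg {Ifg}; apply: ideal_gen_ind => [|g h|g h Lh]; [exact: (hid0 hA)|exact: (hidD hA)|].
  apply: (hidM hA); have [h1 _] := Lh.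
  rewrite -(to_pieceK h1); apply: linear_eqs_adds => //.
  by apply/linear_eqsP; rewrite to_pieceK.
move=> /(addsP _ _ hI)[g [h [Ig fE]]]; exists (f - g); last by rewrite subKr.
rewrite fE addrC addKr; apply: big_ind => [|a b|i _]; [exact: ideal_gen0|exact: ideal_genD|].
rewrite mulrC; apply: ideal_genM; apply: ideal_gen_mem.
have iL : (i < size (vbasis (linear_eqs U)))%N by have := ltn_ord i; rewrite {2}size_map.
rewrite (nth_map 0) //; apply/linear_eqsP; rewrite vbasis_mem // memt_nth //.
by rewrite size_tuple in iL.
Qed.

Theorem hilbert_section (e : nat) : proj_degree (recip_space L) e ->
  meets_in_points (recip_space L) U e ->
  forall q : nat, (d <= q)%N -> hilbert_function (section_ideal (recip_space L) U) q e.
Proof.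
move=> [P [N0 PN] eP] [m [p [mu [pP _ pall _]]]] q dq.
have hI := arr_ideal_hid W; have s1 := linear_section_forms.
have hA := adds_hid hI s1; have ss := size_section_forms.
have p0 i : p i != 0 by have [/recip_space_neq0] := pP i.
have [t t1 tp] := avoiding_linear_form p0.
have s't1 : linear_forms (rcons section_forms t) by rewrite linear_forms_rcons t1.
have hAt := adds_hid hI s't1.
(* A point of the reciprocal space outside [U] violates an equation of [U], and a point inside is
   proportional to some [p i], where [t] is nonzero. So there is no common zero, but [N] is not
   controlled. *)
have [N sN] : exists N, spans (adds (arr_ideal W) (rcons section_forms t)) N.
  apply: nullstellensatz_recip => // [f|v Zv]; first exact: sub_adds.
  have [vU|vU] := boolP (v \in U).
    have [i [c c0 vE]] := pall v Zv vU; exists 1%N, t; split=> //.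
      by have := addl_mul t 1 hA; rewrite mulr1 adds_rcons.
    have -> : t.@[v 0] = t.@[fun l => c * p i 0 l].
      by apply: meval_eq => l; rewrite vE mxE.
    by rewrite (meval_homogZ _ _ t1) mulf_neq0 // expr1.
  apply: contrapT => nf; move/negP: vU; apply; apply: mem_linear_eqs => u uU.
  apply/eqP; apply: contrapT => /negP uv; apply: nf.
  exists 1%N, (val u); split=> //; first exact: valP.
  by rewrite adds_rcons; apply: sub_addl; apply: linear_eqs_adds.
have [_ [s [sz sl _ rs sp]]] := arr_structure_all W.
rewrite dim_row_vspace (maxn_idPr _) // in sz sp.
have sz' : size s = size (rcons section_forms t) by rewrite size_rcons ss.
have hS := adds_hid hI sl.
have rt : regs (arr_ideal W) (rcons section_forms t).
  apply: (regs_exchange (N := maxn N d.+1) hI sl s't1 sz' rs).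
    exact: spans_le (leq_maxr _ _) sp.
  exact: spans_le (leq_maxl _ _) sN.
have /regs_rcons[rA rAt] := rt.
(* Now [N] is sharpened to d + 1: both sequences are regular of equal length, so their quotients
   have the same Hilbert function, and that of [s] vanishes in degree d + 1. *)
have sd : spans (addl (adds (arr_ideal W) section_forms) t) d.+1.
  rewrite -adds_rcons; apply/hf_full => //.
  rewrite -(hf_adds_eq hI hI sl s't1 sz' rs rt (fun=> erefl)).
  exact/(hf_full _ hS).
have hc := hf_const hA t1 rAt sd.
set c := hf (adds _ _) d in hc.
(* Multiplication by the regular form [t] makes the Hilbert function nondecreasing, and it is
   positive in degree 0 because 1 is not in the ideal. Positivity of [c] is what fixes the degree of
   [P] as d. *)
have c0 : (0 < c)%N.
  have mono k : (hf (adds (arr_ideal W) section_forms) 0 <=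
                 hf (adds (arr_ideal W) section_forms) k)%N.
    elim: k => // k IH; apply: leq_trans IH _.
    by rewrite -(hf_reg (q := k) hA t1 (fun f _ => rAt f)) leq_addl.
  apply: leq_trans (mono d); rewrite hf_adds0 //; apply: hf_ne0 => // sI.
  have [w gw] := generic_exists W.
  by have := sI 1 (dhomog1 _ _) w gw; rewrite meval1 => /eqP; rewrite oner_eq0.
have [|sP lP] := hilbert_polynomial_lead hI s1 rA _ hc c0 (P := P) (N := N0).
  move=> k Nk; have [h hh ->] := PN k Nk.
  by rewrite vanishing_ideal_recip in hh; rewrite (hilbert_function_unique hI hh).
have ec : e = c.
  move/eqP: eP; rewrite sP ss /= -ss lP eqr_nat => /eqP; exact.
rewrite ec section_ideal_recip -(hc q dq); exact: hilbert_function_hf.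
Qed.

End ReciprocalSpace.

Theorem theorem1p3 (R : realType) (d n : nat) (L : 'M[R[i]]_(d.+1, n.+1))
  (rankL : \rank L = d.+1)
  (nonconstL : forall i : 'I_n.+1, exists x y : 'rV[R[i]]_d,
     ell L x i <> ell L y i)
  (U : {vspace 'rV[R[i]]_n.+1}) (dimU : \dim U = (n - d).+1)
  (e : nat) (degL : proj_degree (recip_space L) e)
  (meetU : meets_in_points (recip_space L) U e) :
  forall q : nat, (d <= q)%N ->
    hilbert_function (section_ideal (recip_space L) U) q e.
Proof. exact: (@hilbert_section R[i] d n L rankL nonconstL U dimU e degL meetU). Qed.
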